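(* Let $s \in (\sqrt{2}, 2]$, let $T_s : [0,1] \to [0,1]$, $T_s(x) = \min\{sx, s(1-x)\}$, be the tent map of slope $\pm s$, let $K_s = \varprojlim([0,1], T_s)$ be its inverse limit space, and let $\sigma : K_s \to K_s$ be the shift homeomorphism. If $h : K_s \to K_s$ is a homeomorphism and $R \in \mathbb{Z}$ is such that $h$ is isotopic to $\sigma^R$, then the topological entropy of $h$ is $h_{top}(h) = |R| \log s$.
   Context: The inverse limit space is the set of all backward orbits $$K_s = \{ x = (\dots, x_{-2}, x_{-1}, x_0) : x_{-i} \in [0,1],\ T_s(x_{-i-1}) = x_{-i} \text{ for all } i \ge 0 \}$$ (all coordinates then lie in $[0, s/2]$), equipped with the metric $d(x,y) = \sum_{n \le 0} 2^n |x_n - y_n|$; it is a compact metric space. The shift homeomorphism is $$\sigma(\dots, x_{-2}, x_{-1}, x_0) = (\dots, x_{-2}, x_{-1}, x_0, T_s(x_0)).$$ Two homeomorphisms $f, g : X \to X$ are isotopic if there is a continuous map $H : X \times [0,1] \to X$ with $H(\cdot,0) = f$, $H(\cdot,1) = g$ and $H(\cdot,t)$ a homeomorphism of $X$ for every $t \in [0,1]$. Topological entropy $h_{top}$ is the usual one (e.g. defined by Bowen's $(n,\varepsilon)$-separated sets). It is known from earlier work that for every $s \in (\sqrt2, 2]$ and every homeomorphism $h : K_s \to K_s$ an integer $R$ with $h$ isotopic to $\sigma^R$ exists. *)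

(* Defs.v *)
From HB Require Import structures.
From mathcomp Require Import all_boot all_order all_algebra finmap.
From mathcomp Require Import all_classical all_reals all_analysis.
From mathcomp Require Import lra.

Set Implicit Arguments.
Unset Strict Implicit.
Unset Printing Implicit Defensive.

Import Order.TTheory GRing.Theory Num.Theory.
Import numFieldNormedType.Exports.

Local Open Scope classical_set_scope.
Local Open Scope ring_scope.

Definition homeomorphism (X Y : topologicalType) (f : X -> Y) : Prop :=
  continuous f /\
  exists g : Y -> X, [/\ continuous g, cancel f g & cancel g f].

Definition isotopic (R : realType) (X : topologicalType) (f g : X -> X) : Prop :=
  exists H : X * R -> X,
    [/\ {within [set: X] `*` `[0, 1], continuous H},
        forall x, H (x, 0) = f x,
        forall x, H (x, 1) = g x &
        forall t, t \in `[0, 1] -> homeomorphism (fun x => H (x, t))].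

Section topological_entropy.
Context {R : realType} {X : metricType R}.
Implicit Types (f : X -> X) (n : nat) (e : R).
Local Open Scope ereal_scope.

Definition orbit_separated f n e (A : {fset X}) : Prop :=
  forall x y, x \in A -> y \in A -> x <> y ->
    exists2 i, (i < n)%N & (e < mdist (iter i f x) (iter i f y))%R.

Definition max_separated f n e : \bar R :=
  ereal_sup [set (#|` A|%:R)%:E | A in orbit_separated f n e].

Definition separated_growth f e : \bar R :=
  limn_esup (fun n => (n%:R^-1)%:E * lne (max_separated f n e)).

Definition topological_entropy f : \bar R :=
  lim (separated_growth f e @[e --> 0%R^'+]).

End topological_entropy.

Definition tent (R : realType) (s x : R) : R :=
  Num.min (s * x) (s * (1 - x)).

(* The backward orbit (..., x_{-2}, x_{-1}, x_0) is indexed by nat: coordinate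
   n is x_{-n}. *)
Record tent_invlim (R : realType) (s : R) := TentInvLim {
  coord :> nat -> R ;
  coord_itv : forall n, 0 <= coord n <= 1 ;
  tent_coord : forall n, tent s (coord n.+1) = coord n }.

HB.instance Definition _ (R : realType) (s : R) := gen_eqMixin (tent_invlim s).
HB.instance Definition _ (R : realType) (s : R) :=
  gen_choiceMixin (tent_invlim s).

Section tent_invlim_metric.
Context {R : realType} {s : R}.
Implicit Types x y z : tent_invlim s.

Lemma tent_invlim_eq x y : (forall n, x n = y n) -> x = y.
Proof.
case: x y => [x xI xT] [y yI yT] /= /funext xy; rewrite {}xy in xI xT *.
by congr TentInvLim; exact: Prop_irrelevance.
Qed.

Definition invlim_dist x y : R :=
  limn (series (fun n => 2 ^- n * `|x n - y n|)).

Lemma invlim_dist_term_ge0 x y n : 0 <= 2 ^- n * `|x n - y n|.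
Proof. by rewrite mulr_ge0// invr_ge0 exprn_ge0. Qed.

Lemma is_cvg_invlim_dist x y :
  cvgn (series (fun n => 2 ^- n * `|x n - y n|)).
Proof.
apply: (@series_le_cvg _ _ (geometric 1 2^-1)).
- exact: invlim_dist_term_ge0.
- by move=> n; rewrite /= mul1r exprn_ge0// invr_ge0.
- move=> n; rewrite /= mul1r exprVn ler_piMr ?invr_ge0 ?exprn_ge0//.
  have /andP[x0 x1] := coord_itv x n; have /andP[y0 y1] := coord_itv y n.
  by rewrite ler_norml; apply/andP; split; lra.
- by apply: is_cvg_geometric_series; rewrite ger0_norm// invf_lt1 ?ltr1n.
Qed.

Lemma invlim_distxx x : invlim_dist x x = 0.
Proof.
rewrite /invlim_dist (_ : series _ = cst 0) ?lim_cst//.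
by apply/funext => n; rewrite /series/= big1// => i _; rewrite subrr normr0 mulr0.
Qed.

Lemma invlim_dist_positivity x y : invlim_dist x y = 0 -> x = y.
Proof.
move=> d0; apply: tent_invlim_eq => n; apply/eqP; rewrite -subr_eq0 -normr_le0.
rewrite -(@pmulr_rle0 _ (2 ^- n)) ?invr_gt0 ?exprn_gt0// -d0.
apply: (@le_trans _ _ (series (fun n => 2 ^- n * `|x n - y n|) n.+1)).
  rewrite /series/= big_nat_recr//= lerDr; apply: sumr_ge0 => i _.
  exact: (invlim_dist_term_ge0 x y i).
apply: nondecreasing_cvgn_le; last exact: is_cvg_invlim_dist.
by apply: nondecreasing_series => i _ _; exact: invlim_dist_term_ge0.
Qed.

Lemma invlim_dist_sym x y : invlim_dist x y = invlim_dist y x.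
Proof.
by rewrite /invlim_dist; under eq_fun do rewrite distrC.
Qed.

Lemma invlim_dist_triangle y x z :
  invlim_dist x z <= invlim_dist x y + invlim_dist y z.
Proof.
rewrite /invlim_dist -lim_seriesD; try exact: is_cvg_invlim_dist.
apply: lim_series_le; first exact: is_cvg_invlim_dist.
  by apply: is_cvg_seriesD; exact: is_cvg_invlim_dist.
by move=> n; rewrite [leRHS]/= -mulrDr ler_wpM2l ?invr_ge0 ?exprn_ge0// ler_distD.
Qed.

HB.instance Definition _ := @isMetric.Build R (tent_invlim s) invlim_dist
  invlim_distxx invlim_dist_positivity invlim_dist_sym invlim_dist_triangle.

End tent_invlim_metric.

Section shift.
Context {R : realType} {s : R}.

Lemma tent_itv (hs : 0 <= s <= 2) (x : R) : 0 <= x <= 1 -> 0 <= tent s x <= 1.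
Proof.
move: hs => /andP[s0 s2] /andP[x0 x1]; rewrite /tent le_min ge_min.
rewrite !mulr_ge0 ?subr_ge0//=; apply/orP.
have [xh|xh] := leP x 2^-1; [left|right].
  by rewrite (le_trans (ler_pM _ _ s2 xh))// divff.
rewrite (le_trans (@ler_pM _ s 2 (1 - x) 2^-1 s0 _ s2 _)) ?subr_ge0 ?divff//.
by rewrite lerBlDl [leLHS](splitr 1) !div1r lerD// ltW.
Qed.

Definition shift_coord (x : nat -> R) (n : nat) : R :=
  if n is m.+1 then x m else tent s (x 0%N).

Lemma shift_coord_itv (hs : 0 <= s <= 2) (x : tent_invlim s) n :
  0 <= shift_coord x n <= 1.
Proof. by case: n => [|n]; [apply: tent_itv hs _ _|]; exact: coord_itv. Qed.

Lemma tent_shift_coord (x : tent_invlim s) n :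
  tent s (shift_coord x n.+1) = shift_coord x n.
Proof. by case: n => [//|n]; exact: tent_coord. Qed.

Definition shift (hs : 0 <= s <= 2) (x : tent_invlim s) : tent_invlim s :=
  TentInvLim (shift_coord_itv hs x) (tent_shift_coord x).

Definition unshift (x : tent_invlim s) : tent_invlim s :=
  @TentInvLim R s (fun n => x n.+1)
    (fun n => coord_itv x n.+1) (fun n => tent_coord x n.+1).

Lemma shiftK (hs : 0 <= s <= 2) : cancel (shift hs) unshift.
Proof. by move=> x; apply: tent_invlim_eq. Qed.

Lemma unshiftK (hs : 0 <= s <= 2) : cancel unshift (shift hs).
Proof.
by move=> x; apply: tent_invlim_eq => -[|n]//=; rewrite tent_coord.
Qed.

(* sigma ^ k for k : int, with unshift = sigma^-1; note that Negz n = - n.+1. *)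
Definition shift_pow (hs : 0 <= s <= 2) (k : int) :
    tent_invlim s -> tent_invlim s :=
  match k with
  | Posz n => iter n (shift hs)
  | Negz n => iter n.+1 unshift
  end.

End shift.

Lemma slope_itv (R : realType) (s : R) : Num.sqrt 2 < s <= 2 -> 0 <= s <= 2.
Proof.
by move=> /andP[s0 ->]; rewrite andbT (le_trans (sqrtr_ge0 2))// ltW.
Qed.

(* Main.v *)
(** Put kap = |k| and let g be h^-1 if k >= 0 and h otherwise, so that, leafwise, g is
    close to sigma^-kap: applying sigma^-kap to the paths of the isotopy, if k >= 0,
    joins sigma^-kap y to g y by a bounded number of small connected sets, uniformly
    in y. As s > sqrt 2, small connected sets are contracted by sigma^-1 at the rate
    sqrt 2 / s, hence the displacement of g^a from sigma^(- kap a) is under control for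
    all a.

    Upper bound. A box is a set of points whose n-th coordinate lies in an interval whose
    images under T^j, j <= n, are all short; about s^n boxes cover K_s. A box at a high
    level n is, up to a small error, a connected set Q. The sets g^i Q, i < p, are covered
    by O(p) small connected sets, which pull back to intervals of some fixed coordinate:
    as intervals cut each other additively, and not multiplicatively, the (p, e)-separated
    subsets of a box have at most polynomially many points in p. Moreover g^p maps a box
    of level n + kap p into O(p) boxes of level n. Iterating, there are at most
    s^(kap m) poly(p)^(m / p) points in an (m, e)-separated set; let p go to infinity.

    Lower bound. For a large enough L, the L-th coordinate of g^a u is as close as desired
    to the (L + kap a)-th coordinate of u, uniformly in a and u, so that separated sets of
    T^kap in the interval give separated sets of g. *)

Require Import Defs.
From mathcomp Require Import all_boot all_order all_algebra finmap.
From mathcomp Require Import all_classical all_reals all_analysis.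
From mathcomp Require Import lra ring zify.

Import Order.TTheory GRing.Theory Num.Theory.
Import numFieldNormedType.Exports.

Set Implicit Arguments.
Unset Strict Implicit.
Unset Printing Implicit Defensive.

Local Open Scope classical_set_scope.
Local Open Scope ring_scope.

(** * Counting separated points *)

Lemma fset_argmin d (T : orderType d) (K : choiceType) (E : {fset K})
    (u : K -> T) :
  E != fset0 -> exists2 e, e \in E & forall x, x \in E -> (u e <= u x)%O.
Proof.
elim/finSet_rect: E => E IH /fset0Pn[e eE].
have [E0|E0] := eqVneq (E `\ e)%fset fset0.
  exists e => // x xE; have [->//|xe] := eqVneq x e.
  have : x \in (E `\ e)%fset by rewrite !inE xe.
  by rewrite E0 inE.
have [e' e'E le'] := IH _ (fproperD1 eE) E0.
have e'in : e' \in E by move: e'E; rewrite !inE => /andP[].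
have [ee'|e'e] := leP (u e) (u e').
  exists e => // x xE; have [->//|xe] := eqVneq x e.
  by rewrite (le_trans ee')// le'// !inE xe.
exists e' => // x xE; have [->|xe] := eqVneq x e; first exact: ltW.
by rewrite le'// !inE xe.
Qed.

Lemma fset_argmax d (T : orderType d) (K : choiceType) (E : {fset K})
    (u : K -> T) :
  E != fset0 -> exists2 e, e \in E & forall x, x \in E -> (u x <= u e)%O.
Proof. exact: (@fset_argmin _ (T^d)%O K E u). Qed.

Lemma card_fset_cover (K : choiceType) (J : eqType) (L : seq J)
    (P : J -> K -> Prop) (c : nat) (E : {fset K}) :
    (forall x, x \in E -> exists2 l, l \in L & P l x) ->
    (forall l (F : {fset K}), l \in L -> (F `<=` E)%fset ->
      (forall x, x \in F -> P l x) -> (#|` F| <= c)%N) ->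
  (#|` E| <= size L * c)%N.
Proof.
elim: L E => [|l L IH] E cov bnd.
  rewrite leqn0 cardfs_eq0; apply/eqP/fsetP => x; rewrite inE.
  by apply/negbTE/negP => /cov[].
rewrite -(cardfsID [fset x in E | `[< P l x >]]%fset) mulSn leq_add//.
  apply: (bnd l); rewrite ?mem_head ?fsubsetIl// => x.
  by rewrite !inE => /andP[_ /andP[_ /asboolP]].
apply: IH => [x|l' F l'L FE FP].
  rewrite !inE negb_and => /andP[/orP[/negP//|/asboolPn nPx] xE].
  have [l' + Pl'] := cov _ xE; rewrite inE => /orP[/eqP ll'|]; last by exists l'.
  by rewrite ll' in Pl'.
apply: (bnd l') => //; first by rewrite inE l'L orbT.
exact: fsubset_trans FE (fsubsetDl _ _).
Qed.

(* Two points are told apart by an interval containing exactly one of them. Scanning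
   the points from left to right, an interval once left is never entered again. *)
Lemma card_fset_intervals (R : realType) (K : choiceType) (J : eqType)
    (U : J -> set R) (u : K -> R) (L : seq J) (E : {fset K}) :
    (forall l, is_interval (U l)) ->
    (forall x y, x \in E -> y \in E -> x <> y ->
      exists l, [/\ l \in L, U l (u x) & ~ U l (u y)]) ->
  (#|` E| <= (size L).+1)%N.
Proof.
move=> UI; have [n] := ubnP (size L); elim: n L E => // n IH L E Ln sep.
have [->|E0] := eqVneq E fset0; first by rewrite cardfs0.
have [e eE emin] := fset_argmin u E0.
rewrite (cardfsD1 e) eE add1n ltnS.
have [->|E'0] := eqVneq (E `\ e)%fset fset0; first by rewrite cardfs0.
have [e' e'E e'min] := fset_argmin u E'0.
have /andP[e'e e'E'] : (e' != e) && (e' \in E) by move: e'E; rewrite !inE.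
have ee' : e <> e' by move/esym/eqP; rewrite (negbTE e'e).
have [k [kL Uke Uke']] := sep e e' eE e'E' ee'.
have sz : (size [seq l <- L | l != k] < size L)%N.
  rewrite size_filter -(count_predC (pred1 k) L) -[X in (X < _)%N]add0n.
  by rewrite ltn_add2r -has_count has_pred1.
apply: leq_trans (sz); apply: IH; first exact: leq_trans sz Ln.
move=> x y xE yE xy.
have /andP[_ xE'] : (x != e) && (x \in E) by move: xE; rewrite !inE.
have /andP[_ yE'] : (y != e) && (y \in E) by move: yE; rewrite !inE.
have [l [lL Ulx Uly]] := sep x y xE' yE' xy.
exists l; split => //; rewrite mem_filter lL andbT.
apply/eqP => lk; apply: Uke'; rewrite lk in Ulx.
apply: (UI k _ _ Uke Ulx); apply/andP.
by split; [exact: emin|exact: e'min].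
Qed.

(** By induction, a point is kept when it is close to none of those kept before. The points kept are
    separated, hence few, and are the centres of classes covering [E]. *)
Lemma maximal_separated (K : choiceType) (close : K -> K -> Prop) (E : {fset K}) :
    (forall x, close x x) -> (forall x y, close x y -> close y x) ->
  exists F : {fset K}, [/\ (F `<=` E)%fset,
    (forall x y, x \in F -> y \in F -> x <> y -> ~ close x y) &
    forall x, x \in E -> exists2 y, y \in F & close y x].
Proof.
move=> cxx csym; elim/finSet_rect: E => E IH.
have [->|/fset0Pn[e eE]] := eqVneq E fset0; first by exists fset0; split.
have [F [FE Fsep Fcov]] := IH _ (fproperD1 eE).
have FE' : (F `<=` E)%fset by exact: fsubset_trans FE (fsubD1set _ _).
have [[y yF ye]|noy] := pselect (exists2 y, y \in F & close y e).
  exists F; split => // x xE; have [->|xe] := eqVneq x e; first by exists y.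
  by apply: Fcov; rewrite !inE xe.
exists (e |` F)%fset; split.
- by apply/fsubsetP => x; rewrite !inE => /orP[/eqP->//|/(fsubsetP FE')].
- move=> x y; rewrite !inE => /orP[/eqP->|xF] /orP[/eqP->|yF] xy//.
  + by move=> /csym ?; apply: noy; exists y.
  + by move=> ?; apply: noy; exists x.
  + exact: Fsep.
- move=> x xE; have [->|xe] := eqVneq x e; first by exists e; rewrite ?inE ?eqxx.
  have [|y yF yx] := Fcov x; first by rewrite !inE xe.
  by exists y; rewrite ?inE ?yF ?orbT.
Qed.

(** * The tent map and the coordinates of its inverse limit *)

Section tent_map.
Context {R : realType} {s : R} (s0 : 0 <= s).
Implicit Types x y : R.

Lemma tent_left x : x <= 2^-1 -> tent s x = s * x.
Proof. by move=> xh; rewrite /tent min_l// ler_wpM2l//; lra. Qed.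

Lemma tent_right x : 2^-1 <= x -> tent s x = s * (1 - x).
Proof. by move=> xh; rewrite /tent min_r// ler_wpM2l//; lra. Qed.

Lemma tent_same_branch x y :
    (x <= 2^-1) && (y <= 2^-1) || (2^-1 <= x) && (2^-1 <= y) ->
  `|tent s x - tent s y| = s * `|x - y|.
Proof.
case/orP => /andP[xh yh].
  by rewrite !tent_left// -mulrBr normrM (ger0_norm s0).
rewrite !tent_right// -mulrBr normrM (ger0_norm s0) -[in RHS]normrN.
by congr (_ * `| _ |); lra.
Qed.

Lemma tent_lipschitz x y : `|tent s x - tent s y| <= s * `|x - y|.
Proof.
wlog xy : x y / x <= y.
  move=> W; have [|/ltW] := leP x y; first exact: W.
  by rewrite distrC (distrC x); exact: W.
have [yh|hy] := leP y 2^-1.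
  by rewrite tent_same_branch// yh (le_trans xy yh).
have [xh|hx] := leP 2^-1 x.
  by rewrite tent_same_branch// xh (ltW hy) orbT.
rewrite (tent_left (ltW hx)) (tent_right (ltW hy)) -mulrBr normrM (ger0_norm s0).
rewrite ler_wpM2l//; rewrite (ler0_norm (_ : x - y <= 0)) ?subr_le0//.
by rewrite ler_norml; apply/andP; split; lra.
Qed.

Lemma tent_continuous : continuous (tent s).
Proof.
move=> x; apply/cvgrPdist_lt => e e0.
have s1 : 0 < s + 1 by rewrite ltr_wpDl.
near=> y.
apply: le_lt_trans (tent_lipschitz _ _) _.
apply: (@le_lt_trans _ _ ((s + 1) * `|x - y|)).
  by rewrite ler_wpM2r// lerDl.
rewrite mulrC -ltr_pdivlMr//; near: y.
by apply: cvgr_dist_lt => //; rewrite divr_gt0.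
Unshelve. all: by end_near. Qed.

Lemma tent_le x : tent s x <= s / 2.
Proof.
rewrite /tent ge_min; have [xh|/ltW hx] := leP x 2^-1.
  by rewrite ler_wpM2l.
by apply/orP; right; rewrite ler_wpM2l//; lra.
Qed.

Lemma tent_divK (s_gt0 : 0 < s) x : x <= s / 2 -> tent s (x / s) = x.
Proof.
move=> xh; rewrite tent_left; first by rewrite mulrCA divff ?mulr1 ?gt_eqF.
by rewrite ler_pdivrMr// mulrC.
Qed.

Lemma iter_tent_lipschitz n x y :
  `|iter n (tent s) x - iter n (tent s) y| <= s ^+ n * `|x - y|.
Proof.
elim: n => [|n IH]; first by rewrite expr0 mul1r.
by rewrite (le_trans (tent_lipschitz _ _))// exprS -mulrA ler_wpM2l.
Qed.

Lemma iter_tent_itv n x : s <= 2 -> 0 <= x <= 1 -> 0 <= iter n (tent s) x <= 1.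
Proof.
move=> s2; have hs : 0 <= s <= 2 by rewrite s0.
by move=> x01; elim: n => //= n IH; exact: tent_itv.
Qed.

End tent_map.

Section coordinates.
Context {R : realType} {s : R}.
Local Notation X := (tent_invlim s).
Implicit Types x y : X.

Lemma coord_iter x j n : iter j (tent s) (x (j + n)%N) = x n.
Proof. by elim: j n => //= j IH n; rewrite addSnnS IH tent_coord. Qed.

Lemma coord_le (s0 : 0 <= s) x n : x n <= s / 2.
Proof. by rewrite -(tent_coord x n); exact: tent_le. Qed.

Lemma coord_ge0 x n : 0 <= x n.
Proof. by case/andP: (coord_itv x n). Qed.

Lemma coord_le1 x n : x n <= 1.
Proof. by case/andP: (coord_itv x n). Qed.

Lemma coord_dist_le1 x y n : `|x n - y n| <= 1.
Proof.
have := coord_ge0 x n; have := coord_le1 x n.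
have := coord_ge0 y n; have := coord_le1 y n => *.
by rewrite ler_norml; apply/andP; split; lra.
Qed.

Lemma iter_unshift_coord k x n : iter k (@unshift R s) x n = x (n + k)%N.
Proof. by elim: k n => [|k IH] n; rewrite ?addn0//= IH addSnnS. Qed.

Lemma mdistE x y : mdist x y = invlim_dist x y.
Proof. by []. Qed.

Lemma coord_dist_le_mdist x y n : `|x n - y n| <= 2 ^+ n * mdist x y.
Proof.
rewrite -ler_pdivrMl ?exprn_gt0//.
apply: (@le_trans _ _ (series (fun n => 2 ^- n * `|x n - y n|) n.+1)).
  rewrite /series/= big_nat_recr//= lerDr; apply: sumr_ge0 => i _.
  exact: (invlim_dist_term_ge0 x y i).
apply: nondecreasing_cvgn_le; last exact: is_cvg_invlim_dist.
by apply: nondecreasing_series => i _ _; exact: invlim_dist_term_ge0.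
Qed.

Lemma sum_inv2 N : \sum_(0 <= i < N) 2 ^- i = 2 - 2 * 2 ^- N :> R.
Proof.
elim: N => [|N IH]; first by rewrite big_nil expr0; lra.
by rewrite big_nat_recr//= IH exprS invfM; lra.
Qed.

Lemma mdist_le x y n (e : R) :
  (forall j, (j <= n)%N -> `|x j - y j| <= e) -> mdist x y <= 2 * e + 2 ^- n.
Proof.
move=> xye; rewrite mdistE; apply: limr_le; first exact: is_cvg_invlim_dist.
exists n.+1 => // N /= nN.
have e0 : 0 <= e by exact: le_trans (xye 0%N isT).
(* The exact remainder [2 * 2 ^- N] of the geometric tail is subtracted so that the induction on the
   number of terms closes. *)
suff : \sum_(0 <= i < N) 2 ^- i * `|x i - y i| <= 2 * e + (2 ^- n - 2 * 2 ^- N).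
  move/le_trans; apply; have : 0 <= 2 ^- N :> R by rewrite invr_ge0 exprn_ge0.
  by lra.
rewrite -(subnKC nN); elim: (N - n.+1)%N => [|m IH].
  rewrite addn0 exprS invfM mulrA divff ?mul1r ?subrr ?addr0//.
  apply: (@le_trans _ _ (\sum_(0 <= i < n.+1) 2 ^- i * e)).
    by apply: ler_sum_nat => i /andP[_ ni]; rewrite ler_wpM2l ?invr_ge0 ?exprn_ge0 ?xye.
  rewrite -mulr_suml sum_inv2 ler_wpM2r//.
  by have : 0 <= 2 ^- n.+1 :> R by [rewrite invr_ge0 exprn_ge0]; lra.
rewrite addnS big_nat_recr//= exprS invfM.
have : 2 ^- (n.+1 + m) * `|x (n.+1 + m)%N - y (n.+1 + m)%N| <= 2 ^- (n.+1 + m) :> R.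
  by rewrite ler_piMr ?invr_ge0 ?exprn_ge0 ?coord_dist_le1.
by move: IH; lra.
Qed.

Lemma exists_inv2_lt (e : R) : 0 < e -> exists n, 2 ^- n < e.
Proof.
move=> e0; have h : `|2^-1| < 1 :> R by rewrite ger0_norm// invf_lt1 ?ltr1n.
have /cvgrPdist_lt/(_ e e0)[n _ /(_ n (leqnn n))] := cvg_expr h.
by rewrite sub0r normrN normrX ger0_norm// exprVn; exists n.
Qed.

Lemma mdist_le2 x y (e : R) : (forall j, `|x j - y j| <= e) -> mdist x y <= 2 * e.
Proof.
move=> xye; apply/ler_addgt0Pr => d d0.
have [n nd] := exists_inv2_lt d0.
by rewrite (le_trans (mdist_le (n := n) (fun j _ => xye j)))// lerD2l ltW.
Qed.

End coordinates.

(** * Topology of the inverse limit: compactness and uniform continuity *)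

Section topology.
Context {R : realType} {s : R} (s1 : 1 <= s).
Local Notation X := (tent_invlim s).
Implicit Types x y : X.

Let s0 : 0 <= s. Proof. exact: le_trans ler01 s1. Qed.

Lemma coord_dist_iter x y j n :
  (j <= n)%N -> `|x j - y j| <= s ^+ n * `|x n - y n|.
Proof.
move=> jn; rewrite -(coord_iter x (n - j)%N j) -(coord_iter y (n - j)%N j) subnK//.
rewrite (le_trans (iter_tent_lipschitz s0 _ _ _))// ler_wpM2r//.
by rewrite ler_weXn2l// leq_subr.
Qed.

(** Coordinate [n] determines those of smaller index, and the weights of index above [n] sum to
    [2 ^- n]. *)
Lemma mdist_eq_coord x y n : x n = y n -> mdist x y <= 2 ^- n.
Proof.
move=> xy; rewrite -[leRHS]add0r -(mulr0 2); apply: mdist_le => j jn.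
by rewrite (le_trans (coord_dist_iter _ _ jn))// xy subrr normr0 mulr0.
Qed.

Lemma coord_continuous n : continuous (fun x : X => x n).
Proof.
move=> x; apply: (cvgrPdist_lt (F := nbhs x) _ _).2 => e e0; apply/nbhs_ballP.
exists ((2 ^+ n)^-1 * e) => /=; first by rewrite mulr_gt0 ?invr_gt0 ?exprn_gt0.
move=> y; rewrite ballEmdist/= ltr_pdivlMl ?exprn_gt0//.
exact: le_lt_trans (coord_dist_le_mdist x y n).
Qed.

Lemma cvg_coord (F : set_system X) (x : X) : Filter F ->
  (forall n, (fun y : X => y n) @ F --> x n) -> F --> x.
Proof.
move=> FF Fx A /nbhs_ballP[e /= e0 eA]; apply: (filterS eA).
have [n ne] := exists_inv2_lt (divr_gt0 e0 (ltr0n R 2)).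
have d0 : 0 < e / 4 / s ^+ n.
  by rewrite !divr_gt0 ?exprn_gt0// (lt_le_trans ltr01).
have /cvgrPdist_le/(_ _ d0) := Fx n.
apply: filterS => y /= xy; rewrite ballEmdist/=.
apply: le_lt_trans (@mdist_le _ _ x y n (e / 4) _) _.
  move=> j jn; rewrite (le_trans (coord_dist_iter _ _ jn))// mulrC.
  by rewrite -ler_pdivlMr// exprn_gt0// (lt_le_trans ltr01).
by lra.
Qed.

Lemma continuous_coord (T : topologicalType) (f : T -> X) :
  (forall n, continuous (fun t => f t n)) -> continuous f.
Proof. by move=> fc t; apply: cvg_coord => n; exact: fc. Qed.

Lemma unshift_continuous : continuous (@unshift R s).
Proof. by apply: continuous_coord => n; exact: coord_continuous. Qed.

Lemma iter_continuous (T : topologicalType) (f : T -> T) n :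
  continuous f -> continuous (iter n f).
Proof.
move=> fc; elim: n => [|n IH] x; first exact: cvg_id.
by apply: (@continuous_comp _ _ _ (iter n f) f); [exact: IH|exact: fc].
Qed.

Lemma ultra_fmap (T U : Type) (f : T -> U) (F : set_system T) :
  UltraFilter F -> UltraFilter (f @ F).
Proof.
move=> FU; split; first exact: fmap_proper_filter.
move=> G GF sfFG; rewrite predeqE => A; split; last exact: sfFG.
move=> GA; have [//|FnA] := in_ultra_setVsetC (f @^-1` A) FU.
have /filter_ex[? []//] : G (A `&` ~` A) by apply: filterI => //; exact: sfFG.
Qed.

(** As for products: an ultrafilter converges in each coordinate, and the limits form a backward
    orbit because [tent s] is continuous. *)
Lemma tent_invlim_compact : compact [set: X].
Proof.
rewrite compact_ultra => F FU _.
have lim n : exists l, (fun x : X => x n) @ F --> l /\ 0 <= l <= 1.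
  have xI : F ((fun x : X => x n) @^-1` `[0, 1]).
    by apply: filterS (@filterT _ F _) => x _; rewrite /preimage/= in_itv/= coord_itv.
  have := @segment_compact R 0 1; rewrite compact_ultra.
  move=> /(_ _ (ultra_fmap (fun x : X => x n) FU))[].
  - exact: xI.
  - by move=> l [/=]; rewrite in_itv/= => ? ?; exists l.
have /choice[l lP] := lim.
have lT n : tent s (l n.+1) = l n.
  have [ln _] := lP n; have [lSn _] := lP n.+1.
  apply: (@cvg_unique _ (@Rhausdorff R) ((fun x : X => x n) @ F)) => //.
  rewrite (_ : (fun x : X => x n) = tent s \o (fun x : X => x n.+1)).
    by apply: continuous_cvg lSn; exact: tent_continuous.
  by apply/funext => x /=; rewrite tent_coord.
exists (TentInvLim (fun n => (lP n).2) lT); split => //.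
by apply: cvg_coord => n /=; case: (lP n).
Qed.

(** Uniform continuity on a compact space, with nearness expressed by equality of one coordinate of
    large index. It allows a point to be replaced by any other with the same coordinate [n]. *)
Lemma uniform_continuity_coord (f : X -> X) (e : R) : continuous f -> 0 < e ->
  \forall n \near \oo, forall x y, x n = y n -> mdist (f x) (f y) <= e.
Proof.
move=> fc e0; have /compact_near_coveringP cov := tent_invlim_compact.
have e20 : 0 < e / 2 by rewrite divr_gt0.
have := cov nat \oo (fun n x => forall y, x n = y n -> mdist (f x) (f y) <= e).
move=> /(_ _)[]; last 1 first.
  by move=> N _ NP; exists N => // n /= Nn x y; exact: NP.
move=> x _.
have /(_ _ (nbhsx_ballx _ _ e20)) := fc x.
rewrite /= => /nbhs_ballP[d /= d0 dP].
have [N Nd] := exists_inv2_lt (divr_gt0 d0 (ltr0n R 2)).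
have d20 : 0 < d / 2 by rewrite divr_gt0.
exists (ball x (d / 2), [set n | (N <= n)%N]) => /=.
  by split; [exact: nbhsx_ballx|exists N].
move=> [x' n] [/= xx' Nn] y x'y.
have dd : d / 2 <= d by rewrite ler_pdivrMr// ler_peMr ?ler1n// ltW.
have := dP x' (le_ball dd xx'); rewrite /preimage/= ballEmdist/= => fx'.
have xy : mdist x' y < d / 2.
  apply: le_lt_trans (mdist_eq_coord x'y) (le_lt_trans _ Nd).
  by rewrite lef_pV2 ?posrE ?exprn_gt0// ler_weXn2l// ler1n.
have : ball x d y.
  rewrite ballEmdist/= (splitr d); apply: le_lt_trans (metric_triangle _ x' _) _.
  by rewrite ltrD//; move: xx'; rewrite ballEmdist.
move=> /dP; rewrite /= ballEmdist/= => fy.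
rewrite (le_trans (metric_triangle _ (f x) _))// (splitr e).
by rewrite lerD// ltW// metric_sym.
Qed.

End topology.

(** * Contraction of small connected sets by the inverse shift *)

Lemma connected_image (T U : topologicalType) (f : T -> U) (A : set T) :
  continuous f -> connected A -> connected (f @` A).
Proof.
move=> fc Ac; apply: connected_continuous_connected => //.
exact: continuous_subspaceT.
Qed.

Section contraction.
Context {R : realType} {s : R} (hs : Num.sqrt 2 < s <= 2).
Local Notation X := (tent_invlim s).
Implicit Types (x y z w : X) (D : set X) (e : R).

Let sqrt2_gt1 : 1 < Num.sqrt 2 :> R.
Proof. by rewrite -[X in X < _]sqrtr1 ltr_sqrt// ltr1n. Qed.

Let sqrt2_lts : Num.sqrt 2 < s. Proof. by case/andP: hs. Qed.

Lemma slope_gt1 : 1 < s. Proof. exact: lt_trans sqrt2_gt1 sqrt2_lts. Qed.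

Lemma slope_ge1 : 1 <= s. Proof. exact: ltW slope_gt1. Qed.

Lemma slope_gt0 : 0 < s. Proof. exact: lt_trans ltr01 slope_gt1. Qed.

Lemma slope_ge0 : 0 <= s. Proof. exact: ltW slope_gt0. Qed.

(** Two levels contract by [2 / s ^+ 2], since a fold doubles the width at most once; this is the
    mean factor per level. *)
Definition contraction_rate : R := Num.sqrt 2 / s.
Local Notation lam := contraction_rate.

Lemma contraction_rate_gt0 : 0 < lam.
Proof. by rewrite divr_gt0 ?slope_gt0// sqrtr_gt0. Qed.

Lemma contraction_rate_lt1 : lam < 1.
Proof. by rewrite ltr_pdivrMr ?slope_gt0// mul1r. Qed.

Lemma contraction_rateX_gt0 n : 0 < lam ^+ n.
Proof. by rewrite exprn_gt0// contraction_rate_gt0. Qed.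

Lemma contraction_rateX_le1 n : lam ^+ n <= 1.
Proof. by rewrite exprn_ile1// ltW ?contraction_rate_gt0// contraction_rate_lt1. Qed.

Let inv_slope_le : s^-1 <= lam.
Proof. by rewrite -[leLHS]mul1r ler_wpM2r ?invr_ge0 ?slope_ge0// ltW. Qed.

Let contraction_rate_sqr : lam ^+ 2 = 2 / s / s.
Proof. by rewrite expr_div_n sqr_sqrtr// expr2 invfM mulrA. Qed.

(** As [unshift] raises indices by one, the decay in [j] expresses contraction under the inverse
    shift. *)
Definition narrow e D := forall j x y, D x -> D y -> `|x j - y j| <= e * lam ^+ j.

Let same_branch x y n :
    (x n.+1 <= 2^-1) && (y n.+1 <= 2^-1) || (2^-1 <= x n.+1) && (2^-1 <= y n.+1) ->
  `|x n.+1 - y n.+1| = `|x n - y n| / s.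
Proof.
move=> xy; rewrite -(tent_coord x n) -(tent_coord y n) (tent_same_branch slope_ge0)//.
by rewrite mulrAC divff ?mul1r// gt_eqF// slope_gt0.
Qed.

Let crosses D x y n : connected D -> D x -> D y ->
    ~~ ((x n.+1 <= 2^-1) && (y n.+1 <= 2^-1) ||
        (2^-1 <= x n.+1) && (2^-1 <= y n.+1)) ->
  exists2 w, D w & w n.+1 = 2^-1.
Proof.
move=> Dc Dx Dy.
have /connected_intervalP DI : connected ((fun x : X => x n.+1) @` D).
  by apply: connected_image => //; exact: coord_continuous.
have [xy|yx] := leP (x n.+1) (y n.+1).
  have [yh|hy] := leP (y n.+1) 2^-1; first by rewrite (le_trans xy yh).
  have [xh|hx] := leP 2^-1 (x n.+1); first by rewrite (le_trans xh xy) orbT.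
  move=> _; case: (DI (x n.+1) (y n.+1) _ _ 2^-1); [by exists x|by exists y| |].
    by rewrite !ltW.
  by move=> w Dw <-; exists w.
have [xh|hx] := leP (x n.+1) 2^-1.
  by rewrite (le_trans (ltW yx) xh).
have [yh|hy] := leP 2^-1 (y n.+1).
  by rewrite (le_trans yh (ltW yx)) orbT.
move=> _; case: (DI (y n.+1) (x n.+1) _ _ 2^-1); [by exists y|by exists x| |].
  by rewrite !ltW.
by move=> w Dw <-; exists w.
Qed.

Let half_branch x w n : w n.+1 = 2^-1 -> `|x n.+1 - w n.+1| = `|x n - w n| / s.
Proof.
move=> wh; apply: same_branch; rewrite wh lexx !andbT; exact: le_total.
Qed.

Let fold_le D x y w n (d : R) : w n.+1 = 2^-1 ->
    `|x n - w n| <= d -> `|y n - w n| <= d ->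
  `|x n.+1 - y n.+1| <= 2 * d / s.
Proof.
move=> wh xw yw; rewrite (le_trans (ler_distD (w n.+1) _ _))// [X in _ + X]distrC.
rewrite !half_branch// -mulrDl ler_wpM2r ?invr_ge0 ?slope_ge0//.
by rewrite (le_trans (lerD xw yw))//; lra.
Qed.

(* Folding at levels n.+1 and n is impossible: a small interval cannot contain both
   the turning point 1/2 and its image s/2. Two levels thus gain a factor 2/s^2 < 1. *)
Lemma connected_narrow D (d : R) : connected D -> 4 * d < s - 1 ->
  (forall x y, D x -> D y -> `|x 0%N - y 0%N| <= d) -> narrow (2 * d) D.
Proof.
move=> Dc ds D0.
have [->|/set0P[x0 Dx0]] := eqVneq D set0; first by move=> j x y [].
have d0 : 0 <= d by apply: le_trans (D0 x0 x0 Dx0 Dx0).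
have sV0 : 0 <= s^-1 by rewrite invr_ge0 slope_ge0.
have dS n : 2 * d * lam ^+ n / s <= 2 * d * lam ^+ n.+1.
  rewrite exprSr mulrA ler_wpM2l//.
  by rewrite mulr_ge0 ?mulr_ge0// ltW// contraction_rateX_gt0.
(* Two consecutive levels are carried, as a fold at level [n.+2] is estimated from the widths at
   level [n]. *)
suff H n : (forall x y, D x -> D y -> `|x n - y n| <= 2 * d * lam ^+ n) /\
    (forall x y, D x -> D y -> `|x n.+1 - y n.+1| <= 2 * d * lam ^+ n.+1).
  by move=> j; case: (H j).
elim: n => [|n [IHn IHSn]].
  have B0 x y : D x -> D y -> `|x 0%N - y 0%N| <= 2 * d * lam ^+ 0.
    by move=> Dx Dy; rewrite expr0 mulr1 (le_trans (D0 _ _ Dx Dy))//; lra.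
  split=> // x y Dx Dy.
  have [sb|/(crosses Dc Dx Dy)[w Dw wh]] := boolP
      ((x 1%N <= 2^-1) && (y 1%N <= 2^-1) || (2^-1 <= x 1%N) && (2^-1 <= y 1%N)).
    by rewrite same_branch// (le_trans _ (dS 0%N))// ler_wpM2r// B0.
  (* A fold at the first level costs a factor 2 that no earlier level makes up for, whence the
     constant [2 * d]. *)
  have := fold_le D wh (D0 _ _ Dx Dw) (D0 _ _ Dy Dw).
  by move=> /le_trans; apply; have := dS 0%N; rewrite expr0 mulr1.
split=> // x y Dx Dy.
have [sb|/(crosses Dc Dx Dy)[w Dw wh]] := boolP
    ((x n.+2 <= 2^-1) && (y n.+2 <= 2^-1) || (2^-1 <= x n.+2) && (2^-1 <= y n.+2)).
  by rewrite same_branch// (le_trans _ (dS n.+1))// ler_wpM2r// IHSn.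
(* [s / 2] is at distance [(s - 1) / 2 > 2 * d] from the turning point, so at level [n.+1] all of
   [D] lies in the right branch, and the passage from level [n] is free of folds. *)
have w1 : w n.+1 = s / 2.
  by rewrite -tent_coord wh tent_left ?slope_ge0// lexx.
have right z : D z -> 2^-1 <= z n.+1.
  move=> Dz; have := IHSn z w Dz Dw.
  have : 2 * d * lam ^+ n.+1 <= 2 * d.
    by rewrite ler_piMr ?mulr_ge0// contraction_rateX_le1.
  rewrite w1 ler_norml => dd /andP[+ _].
  by move: dd ds; set t := 2 * d * _; lra.
have near z : D z -> `|z n.+1 - w n.+1| <= 2 * d * lam ^+ n / s.
  by move=> Dz; rewrite same_branch ?ler_wpM2r ?IHn// !right// orbT.
rewrite (le_trans (fold_le D wh (near _ Dx) (near _ Dy)))//.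
rewrite -[n.+2]addn2 exprD contraction_rate_sqr.
by rewrite le_eqVlt; apply/orP; left; apply/eqP; ring.
Qed.

Lemma narrow_unshift e D : 0 <= e -> narrow e D -> narrow e (@unshift R s @` D).
Proof.
move=> e0 De j _ _ [x Dx <-] [y Dy <-]; rewrite (le_trans (De j.+1 x y Dx Dy))//.
rewrite ler_wpM2l// exprS ler_piMl ?ltW ?contraction_rateX_gt0//.
exact: contraction_rate_lt1.
Qed.

(** What is kept of a path of the isotopy: a chain of [n] small connected sets. Under iteration the
    lengths of chains add up. *)
Fixpoint linked e n x y : Prop :=
  if n is m.+1 then
    exists z D, [/\ connected D, narrow e D, D x, D z & linked e m z y]
  else x = y.

Lemma linked_trans e m n x y z :
  linked e m x y -> linked e n y z -> linked e (m + n) x z.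
Proof.
elim: m x => [x ->//|m IH x [w [D [Dc De Dx Dw wy]]] yz].
by exists w, D; split => //; exact: IH.
Qed.

Lemma linked_sym e n x y : linked e n x y -> linked e n y x.
Proof.
elim: n x => [x ->//|n IH x [z [D [Dc De Dx Dz zy]]]].
rewrite -addn1; apply: linked_trans (IH _ zy) _.
by exists x, D; split.
Qed.

Lemma linked_unshift e n x y : 0 <= e ->
  linked e n x y -> linked e n (unshift x) (unshift y).
Proof.
move=> e0; elim: n x => [x ->//|n IH x [z [D [Dc De Dx Dz zy]]]].
exists (unshift z), (@unshift R s @` D); split; last exact: IH.
- by apply: connected_image => //; exact: unshift_continuous slope_ge1.
- exact: narrow_unshift.
- by exists x.
- by exists z.
Qed.

Lemma linked_iter_unshift e n k x y : 0 <= e -> linked e n x y ->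
  linked e n (iter k (@unshift R s) x) (iter k (@unshift R s) y).
Proof. by move=> e0 xy; elim: k => //= k; exact: linked_unshift. Qed.

Lemma linked_dist e n x y j :
  linked e n x y -> `|x j - y j| <= n%:R * e * lam ^+ j.
Proof.
elim: n x => [x ->|n IH x [z [D [Dc De Dx Dz zy]]]].
  by rewrite subrr normr0 !mul0r.
rewrite (le_trans (ler_distD (z j) _ _))// -natr1 mulrDl mulrDl mul1r addrC.
by rewrite lerD ?IH// De.
Qed.

(** Consecutive links share a point, so their union is connected. The additional set is the
    singleton of the endpoint, which serves the empty chain. *)
Lemma linked_cover e n x y : 0 <= e -> linked e n x y ->
  exists D : nat -> set X,
    [/\ forall i, connected (D i), forall i, narrow e (D i),
        connected (\bigcup_(i < n.+1) D i), (\bigcup_(i < n.+1) D i) x &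
        (\bigcup_(i < n.+1) D i) y].
Proof.
move=> e0; elim: n x => [x ->|n IH x [z [D [Dc De Dx Dz /IH[E [Ec Ee EUc Ez Ey]]]]]].
  exists (fun=> [set y]); split.
  - by move=> _; exact: connected1.
  - move=> _ j _ _ -> ->; rewrite subrr normr0 mulr_ge0// ltW//.
    exact: contraction_rateX_gt0.
  - by rewrite bigcup_const; [exact: connected1|exists 0%N].
  - by exists 0%N.
  - by exists 0%N.
exists (fun i => if i is i.+1 then E i else D).
have UE : \bigcup_(i < n.+2) (if i is i.+1 then E i else D) =
          D `|` \bigcup_(i < n.+1) E i.
  apply/seteqP; split => [w [[|i] /= ni Ew]|w [Dw|[i /= ni Ew]]].
  - by left.
  - by right; exists i.
  - by exists 0%N.
  - by exists i.+1.
split; rewrite ?UE.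
- by case.
- by case.
- by apply: connectedU => //; exists z.
- by left.
- by right.
Qed.

End contraction.

(** * Paths of the isotopy as chains of small connected sets *)

Section homotopy.
Context {R : realType} {s : R} (hs : Num.sqrt 2 < s <= 2).
Local Notation X := (tent_invlim s).
Variable H : X * R -> X.
Hypothesis Hc : {within [set: X] `*` `[0, 1], continuous H}.

(** Compactness of the product with the time interval makes [r] uniform in [x]. Coordinate 0 is
    enough, since [connected_narrow] passes from it to all coordinates. *)
Lemma homotopy_equicontinuous (d : R) : 0 < d ->
  exists2 r : R, 0 < r & forall x (t u : R), t \in `[0, 1] -> u \in `[0, 1] ->
    `|t - u| < r -> `|H (x, t) 0%N - H (x, u) 0%N| <= d.
Proof.
move=> d0; have d20 : 0 < d / 2 by rewrite divr_gt0.
have Kc : compact ([set: X] `*` `[0, 1]%classic : set (X * R)).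
  apply: compact_setX; last exact: segment_compact.
  exact: tent_invlim_compact (slope_ge1 hs).
move/compact_near_coveringP/near_covering_withinP : Kc => cov.
have := cov R (0 : R)^'+ (fun r p => forall u : R, u \in `[0, 1] ->
  `|p.2 - u| < r -> `|H p 0%N - H (p.1, u) 0%N| <= d).
move=> /(_ _)[]; last first.
  move=> r /= r0 rP; exists (r / 2) => [|x t u t01 u01 tu]; first by rewrite divr_gt0.
  apply: (rP (r / 2)) (x, t) _ u u01 tu => //=.
  - rewrite sub0r normrN gtr0_norm ?divr_gt0//.
    by rewrite ltr_pdivrMr// ltr_pMr// ltr1n.
  - by rewrite divr_gt0.
move=> [x0 t0] K0.
have /subspace_continuousP/(_ _ K0) Hx0 := Hc.
have : (fun p => H p 0%N) @ within ([set: X] `*` `[0, 1]) (nbhs (x0, t0))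
    --> H (x0, t0) 0%N.
  apply: (@cvg_comp _ _ _ H (fun x : X => x 0%N)) Hx0 _.
  exact: coord_continuous.
move=> /cvgrPdist_le/(_ _ d20)[[A B] /= [Ax0 /nbhs_ballP[r /= r0 Br]] ABP].
have r20 : 0 < r / 2 by rewrite divr_gt0.
exists (A `*` ball t0 (r / 2), [set q | q < r / 2]) => /=.
  split; last exact: nbhs_right_lt.
  by exists (A, ball t0 (r / 2)) => //=; split => //; exact: nbhsx_ballx.
move=> [[x t] q] [/= [Ax tt0] qr] [_ /= t01] u u01 tu.
have ballr v : `|t0 - v| < r -> v \in `[0, 1] ->
    `|H (x0, t0) 0%N - H (x, v) 0%N| <= d / 2.
  by move=> t0v v01; apply: (ABP (x, v)); split => //=; exact: Br.
rewrite (splitr d) (le_trans (ler_distD (H (x0, t0) 0%N) _ _))//.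
rewrite lerD//; last first.
  apply: ballr u01; rewrite (le_lt_trans (ler_distD t _ _))// (splitr r).
  by rewrite ltrD// (lt_trans tu).
rewrite distrC ballr// (lt_trans tt0)//.
by rewrite ltr_pdivrMr// ltr_pMr// ltr1n.
Qed.

Lemma homotopy_linked (e : R) : 0 < e ->
  exists N, forall x, linked e N (H (x, 0)) (H (x, 1)).
Proof.
(* The first bound makes the pieces [e]-narrow; the second gives the smallness required by
   [connected_narrow]. *)
move=> e0; pose d := Num.min (e / 2) ((s - 1) / 8).
have s1 := slope_gt1 hs.
have d0 : 0 < d by rewrite lt_min !divr_gt0// subr_gt0.
have de : 2 * d <= e by rewrite mulrC -ler_pdivlMr// ge_min lexx.
have ds : 4 * d < s - 1.
  have : d <= (s - 1) / 8 by rewrite ge_min lexx orbT.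
  by move: s1; clear; lra.
have [r r0 rP] := homotopy_equicontinuous d0.
have [N Nr] : exists N, N.+1%:R^-1 < r.
  by have [N Nr] := ltr_add_invr (y := 0) (x := r) r0; exists N; rewrite add0r in Nr.
exists N.+1 => x.
have N0 : (N.+1%:R : R) != 0 by rewrite pnatr_eq0.
suff L i : (i <= N.+1)%N -> linked e i (H (x, 0)) (H (x, i%:R / N.+1%:R)).
  by have := L N.+1 (leqnn _); rewrite divff.
elim: i => [|i IH] iN; first by rewrite mul0r.
rewrite -addn1; apply: linked_trans (IH (ltnW iN)) _.
pose I := `[i%:R / N.+1%:R : R, (i + 1)%:R / N.+1%:R]%classic.
have II : I `<=` `[0, 1]%classic.
  move=> t; rewrite /I /= !in_itv/= => /andP[it ti]; apply/andP; split.
    by rewrite (le_trans _ it)// divr_ge0.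
  by rewrite (le_trans ti)// ler_pdivrMr ?ltr0n// mul1r ler_nat addn1.
have ends : I (i%:R / N.+1%:R) /\ I ((i + 1)%:R / N.+1%:R).
  by rewrite /I /= !in_itv/= !lexx andbT/= ler_pM2r ?invr_gt0 ?ltr0n// ler_nat leq_addr.
have Dc : connected ((fun t => H (x, t)) @` I).
  apply: connected_continuous_connected; first exact: segment_connected.
  apply/subspace_continuousP => t It.
  have Kt : ([set: X] `*` `[0, 1]) (x, t) by split => //; exact: II.
  have /subspace_continuousP/(_ _ Kt) := Hc.
  apply: cvg_trans; move=> V [/= [A B] /= [Ax Bt] ABV].
  apply: filterS Bt => u Bu Iu; apply: (ABV (x, u)).
    by split => //=; exact: nbhs_singleton.
  by split => //; have := II u Iu.
exists (H (x, (i + 1)%:R / N.+1%:R)), ((fun t => H (x, t)) @` I); split=> //.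
- suff nd : narrow (2 * d) ((fun t => H (x, t)) @` I).
    move=> j y z Dy Dz; rewrite (le_trans (nd j y z Dy Dz))// ler_wpM2r//.
    exact/ltW/(contraction_rateX_gt0 hs).
  apply: (connected_narrow hs) => //; last first.
    move=> _ _ [t It <-] [u Iu <-]; apply: rP (II t It) (II u Iu) _.
    apply: le_lt_trans Nr; move: It Iu; rewrite /I /= !in_itv/= => /andP[it ti] /andP[iu ui].
    have : (i + 1)%:R / N.+1%:R = i%:R / N.+1%:R + N.+1%:R^-1 :> R.
      by rewrite natrD mulrDl mul1r.
    move=> E; move: ti ui it iu; rewrite E.
    move: (i%:R / N.+1%:R : R) (N.+1%:R^-1 : R) => a b *.
    by rewrite ler_norml; apply/andP; split; lra.
- by exists (i%:R / N.+1%:R); case: ends.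
- by exists ((i + 1)%:R / N.+1%:R); case: ends.
Qed.

End homotopy.

(** * Sections of the coordinate maps *)

Section lift.
Context {R : realType} {s : R} (hs : Num.sqrt 2 < s <= 2).
Local Notation X := (tent_invlim s).

Let s0 : 0 < s. Proof. exact: slope_gt0 hs. Qed.

Let s1 : 1 <= s. Proof. exact: slope_ge1 hs. Qed.

Let s2 : s <= 2. Proof. by case/andP: hs. Qed.

(** Makes [lift] defined and continuous on the whole line, without changing the values in
    [[0, s / 2]], where all coordinates lie. *)
Definition clamp (u : R) : R := Num.max (Num.min u (s / 2)) 0.

Lemma clamp_id u : 0 <= u <= s / 2 -> clamp u = u.
Proof. by move=> /andP[u0 us]; rewrite /clamp min_l// max_l. Qed.

Lemma clamp_itv u : 0 <= clamp u <= s / 2.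
Proof.
rewrite /clamp le_max lexx orbT ge_max ge_min lexx orbT/=.
by rewrite divr_ge0// ltW.
Qed.

Lemma clamp_continuous : continuous clamp.
Proof.
apply: (@max_fun_continuous _ _ _ (fun u => Num.min u (s / 2)) (cst 0)).
  apply: (@min_fun_continuous _ _ _ id (cst (s / 2))); first by move=> ?; exact: cvg_id.
  exact: cst_continuous.
exact: cst_continuous.
Qed.

(* Truncated subtraction merges the two cases: the coordinate is T^(n - j) u if
   j <= n, and u / s^(j - n), through the left branch, if n <= j. *)
Definition lift_coord (n : nat) (u : R) (j : nat) : R :=
  iter (n - j) (tent s) (clamp u / s ^+ (j - n)).

Let clamp_div_itv u j : 0 <= clamp u / s ^+ j <= s / 2.
Proof.
have /andP[u0 us] := clamp_itv u.
rewrite divr_ge0 ?exprn_ge0 ?(ltW s0)//= ler_pdivrMr ?exprn_gt0//.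
by rewrite (le_trans us)// ler_peMr ?divr_ge0 ?(ltW s0)// exprn_ege1.
Qed.

Lemma lift_coord_itv n u j : 0 <= lift_coord n u j <= 1.
Proof.
apply: (iter_tent_itv (ltW s0)) => //.
have /andP[-> us] := clamp_div_itv u (j - n)%N.
by rewrite (le_trans us)// ler_pdivrMr// mul1r.
Qed.

Lemma tent_lift_coord n u j : tent s (lift_coord n u j.+1) = lift_coord n u j.
Proof.
rewrite /lift_coord -iterS; have [jn|nj] := ltnP j n.
  by rewrite subnSK// (eqP (ltnW jn)) (eqP jn).
have /eqP-> : (n - j.+1)%N == 0%N by rewrite subn_eq0 ltnW.
have /eqP-> : (n - j)%N == 0%N by rewrite subn_eq0.
rewrite /= subSn// exprSr invfM mulrA tent_divK ?(ltW s0)//.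
by case/andP: (clamp_div_itv u (j - n)%N).
Qed.

Definition lift (n : nat) (u : R) : X :=
  TentInvLim (lift_coord_itv n u) (tent_lift_coord n u).

Lemma lift_le n u j : 0 <= u <= s / 2 -> (j <= n)%N ->
  lift n u j = iter (n - j) (tent s) u.
Proof.
by move=> us jn; rewrite /= /lift_coord (eqP jn) expr0 divr1 clamp_id.
Qed.

Lemma lift_ge n u v j : 0 <= u <= s / 2 -> 0 <= v <= s / 2 -> (n <= j)%N ->
  `|lift n u j - lift n v j| <= `|u - v|.
Proof.
move=> us vs nj; rewrite /= /lift_coord (eqP nj)/= !clamp_id// -mulrBl normrM.
rewrite ler_piMr// normfV ger0_norm ?exprn_ge0 ?(ltW s0)//.
by rewrite invf_le1 ?exprn_gt0// exprn_ege1.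
Qed.

Lemma lift_continuous n : continuous (lift n).
Proof.
apply: (continuous_coord s1) => j u.
apply: (@continuous_comp _ _ _ (fun u => clamp u / s ^+ (j - n)) (iter (n - j) (tent s))).
  by apply: cvgMl; exact: clamp_continuous.
by apply: iter_continuous; exact: tent_continuous (ltW s0).
Qed.

End lift.

(** * Coverings by flat connected sets *)

Section coverings.
Context {R : realType} {s : R} (hs : Num.sqrt 2 < s <= 2).
Local Notation X := (tent_invlim s).
Implicit Types (x y z : X) (e : R) (A : nat -> set X).

Definition flat e (D : set X) := forall j x y, D x -> D y -> `|x j - y j| <= e.

(** The pieces carry no decay, so that the flat image of a lifted box may be inserted between two
    chains of links. *)
Definition covered e m x y := exists A,
  [/\ forall l, connected (A l), forall l, flat e (A l),
      connected (\bigcup_(l < m) A l), (\bigcup_(l < m) A l) x &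
      (\bigcup_(l < m) A l) y].

Lemma narrow_flat e D : 0 <= e -> narrow e D -> flat e D.
Proof.
move=> e0 De j x y Dx Dy; rewrite (le_trans (De j x y Dx Dy))//.
by rewrite ler_piMr// (contraction_rateX_le1 hs).
Qed.

Lemma flat_mdist e D x y : flat e D -> D x -> D y -> mdist x y <= 2 * e.
Proof. by move=> De Dx Dy; apply: mdist_le2 => j; exact: De. Qed.

Lemma linked_covered e n x y : 0 <= e -> linked e n x y -> covered e n.+1 x y.
Proof.
move=> e0 /(linked_cover hs e0)[A [Ac Ae AUc Ax Ay]]; exists A; split => // l.
exact: narrow_flat.
Qed.

Lemma covered1 e (D : set X) x y :
  connected D -> flat e D -> D x -> D y -> covered e 1 x y.
Proof.
move=> Dc De Dx Dy; exists (fun=> D); split => //.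
- by rewrite bigcup_const//; exists 0%N.
- by exists 0%N.
- by exists 0%N.
Qed.

Lemma covered_trans e m n x y z :
  covered e m x y -> covered e n y z -> covered e (m + n) x z.
Proof.
move=> [A [Ac Ae AUc Ax Ay]] [B [Bc Be BUc By Bz]].
exists (fun l => if (l < m)%N then A l else B (l - m)%N).
have UE : \bigcup_(l < (m + n)%N) (if (l < m)%N then A l else B (l - m)%N) =
    (\bigcup_(l < m) A l) `|` (\bigcup_(l < n) B l).
  apply/seteqP; split => [w [l /= lmn]|w [[l /= lm Al]|[l /= ln Bl]]].
  - case: ltnP => [lm Al|ml Bl]; [by left; exists l|right].
    by exists (l - m)%N => //=; rewrite ltn_subLR.
  - by exists l; rewrite /= ?lm// ltn_addr.
  - exists (m + l)%N; first by rewrite /= ltn_add2l.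
    by rewrite ltnNge leq_addr/= addKn.
split; rewrite ?UE.
- by move=> l; case: ifP.
- by move=> l; case: ifP.
- by apply: connectedU => //; exists y.
- by left.
- by right.
Qed.

Lemma covered_sym e m x y : covered e m x y -> covered e m y x.
Proof. by move=> [A [? ? ? ? ?]]; exists A. Qed.

Lemma covered_leq e m n x y : (m <= n)%N -> covered e m x y -> covered e n x y.
Proof.
move=> mn [A [Ac Ae AUc Ax Ay]].
exists (fun l => if (l < m)%N then A l else set0).
have UE : \bigcup_(l < n) (if (l < m)%N then A l else set0) = \bigcup_(l < m) A l.
  apply/seteqP; split => [w [l /= ln]|w [l /= lm Al]].
    by case: ltnP => // lm Al; exists l.
  by exists l; rewrite /= ?lm// (leq_trans lm).
split; rewrite ?UE//.
- by move=> l; case: ifP => // _; exact: connected0.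
- by move=> l; case: ifP => // _ j x' y' [].
Qed.

End coverings.

(** * The upper bound *)

Section upper_bound.
Context {R : realType} {s : R} (hs : Num.sqrt 2 < s <= 2).
Local Notation X := (tent_invlim s).
Implicit Types (x y z : X) (E F G : {fset X}) (I : set R).

Let s0 : 0 < s. Proof. exact: slope_gt0 hs. Qed.

Let s1 : 1 <= s. Proof. exact: slope_ge1 hs. Qed.

Variables (e : R) (e0 : 0 < e).

(** [I] defines a box of level [n], the set of [x] with [x n] in [I]. As [x (n - j)] is the [j]-th
    iterate of [x n], the points of a box agree up to [e] in the coordinates 0 to [n]. *)
Definition good n I := [/\ is_interval I, I `<=` [set u | 0 <= u <= s / 2] &
  forall j u v, (j <= n)%N -> I u -> I v ->
    `|iter j (tent s) u - iter j (tent s) v| <= e].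

Lemma good_leq m n I : (m <= n)%N -> good n I -> good m I.
Proof.
move=> mn [II I0 Ie]; split => // j u v jm.
by apply: Ie; exact: leq_trans jm mn.
Qed.

Lemma flat_good n (D : set X) :
  connected D -> flat e D -> good n ((fun x : X => x n) @` D).
Proof.
move=> Dc De; split.
- by apply/connected_intervalP/connected_image => //; exact: coord_continuous.
- by move=> _ [x _ <-] /=; rewrite coord_ge0 coord_le// ltW.
- move=> j _ _ jn [x Dx <-] [y Dy <-].
  by rewrite -{1}(subnKC jn) -[in X in _ - X](subnKC jn) !coord_iter; exact: De.
Qed.

Lemma good_lift_flat n k I : good n I ->
  flat e (iter k (@unshift R s) @` (lift hs n @` I)).
Proof.
move=> [_ I0 Ie] j _ _ [_ [u Iu <-] <-] [_ [v Iv <-] <-].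
rewrite !iter_unshift_coord; have [jn|/ltnW nj] := leqP (j + k)%N n.
  by rewrite !lift_le ?I0//; apply: Ie => //; rewrite leq_subr.
by rewrite (le_trans (lift_ge hs _ _ nj)) ?I0//; exact: (Ie 0%N).
Qed.

Lemma good_lift_connected n k I : good n I ->
  connected (iter k (@unshift R s) @` (lift hs n @` I)).
Proof.
move=> [II _ _]; apply: connected_image.
  by apply: iter_continuous; exact: unshift_continuous s1.
apply: connected_image; first exact: lift_continuous.
exact/connected_intervalP.
Qed.

Variables (g f : X -> X) (kap N : nat).
Hypotheses (fc : continuous f) (gK : cancel g f) (fK : cancel f g).
Hypothesis gN : forall y, linked e N (iter kap (@unshift R s) y) (g y).

(** [unshift] preserves the length of chains and each application of [g] adds [N] links, so the
    length grows only linearly in [a]. *)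
Lemma iter_linked a y :
  linked e (a * N) (iter (kap * a) (@unshift R s) y) (iter a g y).
Proof.
elim: a => [|a IH]; first by rewrite muln0.
rewrite mulnS mulSn addnC iterD iterS; apply: linked_trans (gN _).
by apply: (linked_iter_unshift hs) => //; exact: ltW.
Qed.

Lemma iter_covered a p y : (a <= p)%N ->
  covered e (p * N).+1 (iter (kap * a) (@unshift R s) y) (iter a g y).
Proof.
move=> ap; have := linked_covered hs (ltW e0) (iter_linked a y).
by apply: covered_leq; rewrite ltnS leq_mul2r ap orbT.
Qed.

(** One more than the number of intervals: for each of [p] times, one piece for the box and
    [(p * N).+1] for the chain at either end. *)
Let cells p := (p * ((p * N).+1 + 1 + (p * N).+1)).+1.

(** At each time [i] the unshifted box and two chains form a connected union of flat pieces, joining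
    the images of two extreme points. Pulled back by [g^-i] and projected to coordinate [n1], the
    pieces become intervals. Those of all times lie on one line, so the bound is linear in their
    number. *)
Lemma card_separated_box p n1 n I E : (n1 <= n)%N -> good n I ->
    (forall i x y, (i < p)%N -> x n1 = y n1 ->
      mdist (iter i g x) (iter i g y) <= e) ->
    (forall x, x \in E -> I (x n)) ->
    (forall x y, x \in E -> y \in E -> x <> y ->
      exists2 i, (i < p)%N & 4 * e < mdist (iter i g x) (iter i g y)) ->
  (#|` E| <= cells p)%N.
Proof.
move=> n1n gI unif EI Esep.
have [->|En0] := eqVneq E fset0; first by rewrite cardfs0.
have [el elE lmin] := fset_argmin (fun x : X => x n1) En0.
have [er erE rmax] := fset_argmax (fun x : X => x n1) En0.
set m := ((p * N).+1 + 1 + (p * N).+1)%N.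
have I0 x : x \in E -> 0 <= x n <= s / 2.
  by move=> xE; case: gI => _ /(_ _ (EI x xE)).
have liftE x : x \in E -> lift hs n (x n) n1 = x n1.
  by move=> xE; rewrite lift_le ?I0// -[in X in iter _ _ (x X)](subnK n1n) coord_iter.
have cov i : (i < p)%N -> covered e m (iter i g (lift hs n (el n)))
                                     (iter i g (lift hs n (er n))).
  move=> /ltnW ip; apply: (covered_trans _ (iter_covered _ ip)).
  apply: (covered_trans (covered_sym (iter_covered _ ip))).
  apply: (covered1 (good_lift_connected (k := (kap * i)%N) gI) (good_lift_flat gI)).
  - by exists (lift hs n (el n)) => //; exists (el n) => //; exact: EI.
  - by exists (lift hs n (er n)) => //; exists (er n) => //; exact: EI.
have /choice[A AP] : forall i, exists A : nat -> set X, (i < p)%N ->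
    [/\ forall l, connected (A l), forall l, flat e (A l),
      connected (\bigcup_(l < m) A l),
      (\bigcup_(l < m) A l) (iter i g (lift hs n (el n))) &
      (\bigcup_(l < m) A l) (iter i g (lift hs n (er n)))].
  move=> i; have [ip|] := boolP (i < p)%N; last by exists (fun=> set0).
  by have [A ?] := cov i ip; exists A.
pose U (q : nat * nat) := if (q.1 < p)%N then
  (fun x : X => x n1) @` (iter q.1 f @` A q.1 q.2) else set0.
have UI q : is_interval (U q).
  rewrite /U; case: ifP => qp; last by move=> ? ? [].
  have [Ac _ _ _ _] := AP _ qp.
  apply/connected_intervalP/connected_image; first exact: coord_continuous.
  by apply: connected_image => //; exact: iter_continuous.
pose L := [seq (i, l) | i <- iota 0 p, l <- iota 0 m].
rewrite /cells -/m; have <- : size L = (p * m)%N by rewrite size_allpairs !size_iota.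
apply: (card_fset_intervals UI (u := fun x : X => x n1)) => x y xE yE xy.
have [i ip exy] := Esep x y xE yE xy.
have [Ac Ae AUc Al Ar] := AP i ip.
have iterK : cancel (iter i g) (iter i f).
  by elim: {+}i => // j IH z; rewrite iterSr/= gK IH.
have iterK' : cancel (iter i f) (iter i g).
  by elim: {+}i => // j IH z; rewrite iterSr/= fK IH.
(* The union pulled back is connected and reaches both extreme values of coordinate [n1], so its
   projection contains [x n1]. *)
have : ((fun z : X => z n1) @` (iter i f @` \bigcup_(l < m) A i l)) (x n1).
  have /connected_intervalP CI :
      connected ((fun z : X => z n1) @` (iter i f @` \bigcup_(l < m) A i l)).
    apply: connected_image; first exact: coord_continuous.
    by apply: connected_image => //; exact: iter_continuous.
  apply: (CI (el n1) (er n1)); last by rewrite lmin//= rmax.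
  - exists (lift hs n (el n)); last exact: liftE.
    by exists (iter i g (lift hs n (el n))).
  - exists (lift hs n (er n)); last exact: liftE.
    by exists (iter i g (lift hs n (er n))).
move=> [_ [w [l /= lm Alw] <-] wx].
have Ulx : U (i, l) (x n1).
  by rewrite /U/= ip; exists (iter i f w) => //; exists w.
exists (i, l); split => //.
  by apply/allpairsP; exists (i, l); rewrite !mem_iota !add0n.
rewrite /U/= ip => -[_ [v Alv <-] vy].
move: exy; rewrite ltNge => /negP; apply.
(* [w] and [v] lie in one piece, and are within [e] of the images of [x] and [y]: in all
   [e + 2 * e + e], against a separation above [4 * e]. *)
have xw := unif i _ _ ip wx; have yv := unif i _ _ ip vy.
rewrite !iterK' in xw yv.
have wv := flat_mdist (Ae l) Alw Alv.
rewrite (le_trans (metric_triangle _ w _))//.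
rewrite (le_trans (lerD (lexx _) (metric_triangle _ v _)))//.
rewrite [mdist _ w]metric_sym.
by move: xw yv wv; lra.
Qed.

Let boxes p := (2 * (p * N).+1).+1.

(** Let [el] and [er] be extreme for coordinate [n] of [g^p]. A value at most that of
    [unshift^(kap p) el] is at least that of [g^p el], hence in a piece of the chain joining them;
    similarly at [er]. Any other value lies between two points of [I], which has the index
    [None]. *)
Lemma good_cover p n I G : good (n + kap * p) I ->
    (forall x, x \in G -> I (x (n + kap * p)%N)) ->
  exists2 U : option (bool * nat) -> set R, forall q, good n (U q) &
    forall x, x \in G -> exists2 q,
      q \in None :: [seq Some (b, l) | b <- [:: true; false], l <- iota 0 (p * N).+1] &
      U q (iter p g x n).
Proof.
move=> gI GI; have gnI := good_leq (leq_addr _ _) gI.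
have [->|Gn0] := eqVneq G fset0; first by exists (fun=> I).
have [el elG lmin] := fset_argmin (fun x : X => iter p g x n) Gn0.
have [er erG rmax] := fset_argmax (fun x : X => iter p g x n) Gn0.
have [A [Ac Ae AUc Ax Ay]] := iter_covered el (leqnn p).
have [B [Bc Be BUc Bx By]] := iter_covered er (leqnn p).
exists (fun q => if q is Some (b, l) then
    (fun x : X => x n) @` (if b then A l else B l) else I).
  by case=> [[[] l]|]//; exact: flat_good.
move=> x xG; set v := iter p g x n.
have startE y : iter (kap * p) (@unshift R s) y n = y (n + kap * p)%N.
  exact: iter_unshift_coord.
have [vl|lv] := leP v (el (n + kap * p)%N).
  have /connected_intervalP CI :
      connected ((fun x : X => x n) @` \bigcup_(l < (p * N).+1) A l).
    by apply: connected_image => //; exact: coord_continuous.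
  have [|||z [l lm Az] zv] := CI (iter p g el n) (el (n + kap * p)%N) _ _ v.
  - by exists (iter p g el).
  - by rewrite -startE; exists (iter (kap * p) (@unshift R s) el).
  - by rewrite vl lmin.
  - exists (Some (true, l)); last by exists z.
    rewrite in_cons; apply/orP; right; apply: allpairs_f; first by rewrite !inE.
    by rewrite mem_iota add0n; exact: lm.
have [vr|rv] := leP (er (n + kap * p)%N) v.
  have /connected_intervalP CI :
      connected ((fun x : X => x n) @` \bigcup_(l < (p * N).+1) B l).
    by apply: connected_image => //; exact: coord_continuous.
  have [|||z [l lm Bz] zv] := CI (er (n + kap * p)%N) (iter p g er n) _ _ v.
  - by rewrite -startE; exists (iter (kap * p) (@unshift R s) er).
  - by exists (iter p g er).
  - by rewrite vr rmax.
  - exists (Some (false, l)); last by exists z.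
    rewrite in_cons; apply/orP; right; apply: allpairs_f; first by rewrite !inE.
    by rewrite mem_iota add0n; exact: lm.
exists None; first exact: mem_head.
case: gI => II _ _; apply: (II (el (n + kap * p)%N) (er (n + kap * p)%N)).
- exact: GI.
- exact: GI.
- by rewrite !ltW.
Qed.

(** By blocks of [p] iterates. A maximal set separated by [4 * e] in the first block has at most
    [cells p] points. The points of [E] close to one of them are sent by [g^p] into [boxes p] boxes
    whose level is lower by [kap * p], where induction applies. *)
Lemma card_orbit_separated_box p n1 b n I E :
    (forall i x y, (i < p)%N -> x n1 = y n1 ->
      mdist (iter i g x) (iter i g y) <= e) ->
    n = (n1 + kap * (p * b))%N -> good n I ->
    (forall x, x \in E -> I (x n)) ->
    orbit_separated g (p * b) (8 * e) E ->
  (#|` E| <= (cells p * boxes p) ^ b)%N.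
Proof.
move=> unif; elim: b n I E => [|b IH] n I E nE gI EI Esep.
  rewrite muln0 in Esep; rewrite expn0.
  apply: (@card_fset_intervals R _ nat (fun=> set0) (fun=> 0) [::] E).
    by move=> _ ? ? [].
  by move=> x y xE yE /(Esep x y xE yE)[].
pose close x y := forall i, (i < p)%N -> mdist (iter i g x) (iter i g y) <= 4 * e.
have [|x y xy i ip|F [FE Fsep Fcov]] := @maximal_separated _ close E.
- by move=> x i _; rewrite mdistxx mulr_ge0// ltW.
- by rewrite metric_sym xy.
have Fc : (#|` F| <= cells p)%N.
  apply: (@card_separated_box p n1 n I F) => //.
  - by rewrite nE leq_addr.
  - by move=> x /(fsubsetP FE); exact: EI.
  - move=> x y xF yF /(Fsep x y xF yF)/existsNP[i] /not_implyP[ip] /negP.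
    by rewrite -ltNge; exists i.
rewrite expnS -mulnA; apply: leq_trans (leq_mul Fc (leqnn _)).
apply: (@card_fset_cover _ _ (enum_fset F) (fun y x => close y x)) => //.
move=> y G yF GE Gy.
have nE' : n = ((n1 + kap * (p * b)) + kap * p)%N.
  by rewrite nE -addnA -mulnDr -mulnSr.
rewrite nE' in gI EI.
have [U Ug Ucov] := good_cover gI (fun x xG => EI x (fsubsetP GE x xG)).
set A := (X in None :: X) in Ucov.
have szA : size A = (2 * (p * N).+1)%N by rewrite size_allpairs size_iota.
have szB : boxes p = size (None :: A) by rewrite /boxes -szA.
rewrite {1}szB.
apply: card_fset_cover Ucov _.
move=> q G' _ G'G G'U.
have giterI : injective (iter p g).
  by elim: {+}p => // j IHj u v /=/(can_inj gK)/IHj.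
have <- : #|` (iter p g @` G')%fset| = #|` G'| by rewrite card_imfset.
apply: (IH (n1 + kap * (p * b))%N (U q)) => //.
  by move=> _ /imfsetP[x /= xG' ->]; exact: G'U.
move=> _ _ /imfsetP[x /= xG' ->] /imfsetP[z /= zG' ->] xz.
have xG := fsubsetP G'G x xG'; have zG := fsubsetP G'G z zG'.
have xz' : x <> z by move=> xz'; apply: xz; rewrite xz'.
have [i ip ei] := Esep x z (fsubsetP GE x xG) (fsubsetP GE z zG) xz'.
(* Both points are within [4 * e] of [y] before time [p], hence within [8 * e] of each other; they
   separate later, and their images under [g^p] do so at time [i - p]. *)
have pi : (p <= i)%N.
  rewrite leqNgt; apply/negP => {}ip; move: ei; rewrite ltNge => /negP; apply.
  have := Gy x xG i ip; have := Gy z zG i ip.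
  have := metric_triangle (iter i g x) (iter i g y) (iter i g z).
  by rewrite [mdist (iter i g x) (iter i g y)]metric_sym; lra.
exists (i - p)%N; first by rewrite ltn_subLR// -mulnS.
by rewrite -!iterD subnK.
Qed.

End upper_bound.

(** * Entropy from cardinalities of separated sets *)

Section entropy_bounds.
Context {R : realType} {X : metricType R}.
Implicit Types (f g : X -> X) (e a c : R) (E : {fset X}).

Lemma limn_esup_le (u : nat -> \bar R) (l : \bar R) :
  (\forall n \near \oo, (u n <= l)%E) -> (limn_esup u <= l)%E.
Proof.
move=> [n0 _ ul]; apply: (@le_trans _ _ (ereal_sup (u @` [set n | (n0 <= n)%N]))).
  by apply: ereal_inf_lbound; exists [set n | (n0 <= n)%N] => //; exists n0.
by apply: ge_ereal_sup => _ [n n0n <-]; exact: ul.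
Qed.

Lemma limn_esup_ge (u : nat -> \bar R) (l : \bar R) :
  (forall n0, exists2 n, (n0 <= n)%N & (l <= u n)%E) -> (l <= limn_esup u)%E.
Proof.
move=> ul; apply: le_ereal_inf_tmp => _ [V [n0 _ n0V] <-].
have [n n0n lu] := ul n0; apply: le_trans lu _.
by apply: ereal_sup_ubound; exists n => //; exact: n0V.
Qed.

Lemma max_separated_ge E f n e : orbit_separated f n e E ->
  ((#|` E|%:R)%:E <= max_separated f n e)%E.
Proof. by move=> Es; apply: ereal_sup_ubound; exists E. Qed.

Lemma separated_growth_ge0 (x : X) f e : (0 <= separated_growth f e)%E.
Proof.
apply: limn_esup_ge => n0; exists n0 => //; rewrite mule_ge0 ?lee_fin ?invr_ge0//.
rewrite lne_ge0; have := @max_separated_ge [fset x]%fset f n0 e.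
rewrite cardfs1; apply=> y z; rewrite !inE => /eqP-> /eqP->; by [].
Qed.

Lemma separated_growth_le f e a c :
    (forall n E, (0 < n)%N -> orbit_separated f n e E ->
      #|` E|%:R <= expR (a + n%:R * c)) ->
  (separated_growth f e <= c%:E)%E.
Proof.
move=> Ele; apply/lee_addgt0Pr => d d0; apply: limn_esup_le.
near=> n.
have n0 : (0 < n)%N by near: n; exists 1%N.
have n0R : 0 < n%:R :> R by rewrite ltr0n.
have le : (lne (max_separated f n e) <= (a + n%:R * c)%:E)%E.
  rewrite -[leRHS](expeRK (a + n%:R * c)%:E) lee_lne.
  - by apply: ge_ereal_sup => _ [E Es <-]; rewrite lee_fin; exact: Ele.
  - rewrite in_itv/= leey andbT; apply: le_trans (@max_separated_ge fset0 f n e _).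
      by rewrite cardfs0.
    by move=> x y; rewrite inE.
  - by rewrite in_itv/= leey andbT lee_fin expR_ge0.
have nV : (0 <= (n%:R^-1)%:E :> \bar R)%E by rewrite lee_fin invr_ge0.
apply: le_trans (lee_wpmul2l nV le) _.
rewrite -EFinM -EFinD lee_fin mulrDr mulrA mulVf ?gt_eqF// mul1r addrC lerD2l.
rewrite mulrC ler_pdivrMr// -ler_pdivrMl//.
by near: n; exact: nbhs_infty_ger.
Unshelve. all: by end_near. Qed.

Lemma separated_growth_ge f e a c :
    (forall n0, exists n E, [/\ (n0 < n)%N, orbit_separated f n e E &
      expR (n%:R * c - a) <= #|` E|%:R]) ->
  (c%:E <= separated_growth f e)%E.
Proof.
move=> Ege; apply/lee_subgt0Pr => d d0; apply: limn_esup_ge => n0.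
have [N aN] : exists N : nat, a / d < N%:R.
  by exists (Num.truncn (a / d)).+1; exact: truncnS_gt.
have [n [E [Nn Es Ebig]]] := Ege (maxn n0 N).
move: Nn; rewrite gtn_max => /andP[n0n Nn]; exists n; first exact: ltnW.
have n0R : 0 < n%:R :> R by rewrite ltr0n (leq_ltn_trans _ n0n).
have le : ((n%:R * c - a)%:E <= lne (max_separated f n e))%E.
  rewrite -[leLHS](expeRK (n%:R * c - a)%:E) lee_lne.
  - by apply: le_trans (max_separated_ge Es); rewrite lee_fin.
  - by rewrite in_itv/= leey andbT lee_fin expR_ge0.
  - rewrite in_itv/= leey andbT; apply: le_trans (max_separated_ge Es).
    by rewrite lee_fin.
have nV : (0 <= (n%:R^-1)%:E :> \bar R)%E by rewrite lee_fin invr_ge0.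
apply: le_trans (lee_wpmul2l nV le).
rewrite -EFinM -EFinB lee_fin mulrBr mulrA mulVf ?gt_eqF// mul1r lerD2l lerN2.
rewrite mulrC ler_pdivrMr// -ler_pdivrMl// mulrC ltW//.
by rewrite (lt_le_trans aN)// ler_nat ltnW.
Qed.

Lemma orbit_separated_leq f m n e E :
  (m <= n)%N -> orbit_separated f m e E -> orbit_separated f n e E.
Proof.
move=> mn Es x y xE yE xy; have [i im exy] := Es x y xE yE xy.
by exists i => //; exact: leq_trans im mn.
Qed.

(** Time reversal: separation of [E] at time [i] under [f] is separation of [f^(n-1) E] at time
    [n - 1 - i] under the inverse. *)
Lemma max_separated_inv f g n e : cancel f g -> cancel g f ->
  (max_separated f n e <= max_separated g n e)%E.
Proof.
move=> fK gK; apply: ge_ereal_sup => _ [E Es <-].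
have finj i : injective (iter i f).
  by elim: i => // i IH u v /=/(can_inj fK)/IH.
have iterK : forall i, cancel (iter i f) (iter i g).
  by elim=> // j IH z; rewrite iterSr/= fK IH.
have <- : #|` (iter n.-1 f @` E)%fset| = #|` E| by rewrite card_imfset.
apply: max_separated_ge => _ _ /imfsetP[x /= xE ->] /imfsetP[y /= yE ->] xy.
have xy' : x <> y by move=> xy'; apply: xy; rewrite xy'.
have [i im exy] := Es x y xE yE xy'.
have n0 : (0 < n)%N by exact: leq_ltn_trans im.
exists (n.-1 - i)%N; first by rewrite (leq_ltn_trans (leq_subr _ _))// prednK.
have ->: n.-1 = ((n.-1 - i) + i)%N by rewrite subnK// -ltnS prednK.
by rewrite !iterD addnK !iterK.
Qed.

Lemma topological_entropy_inv f g : cancel f g -> cancel g f ->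
  topological_entropy f = topological_entropy g.
Proof.
move=> fK gK; rewrite /topological_entropy.
suff -> : separated_growth f = separated_growth g by [].
apply/funext => e; rewrite /separated_growth; congr limn_esup.
apply/funext => n; congr (_ * lne _)%E; apply/eqP.
by rewrite eq_le !max_separated_inv.
Qed.

(** [lim] is meaningful only if the limit exists; the two bounds give convergence, and finiteness
    near 0. *)
Lemma topological_entropyE f c :
    (forall e, 0 < e -> (separated_growth f e <= c%:E)%E) ->
    (forall d, 0 < d -> exists2 r, 0 < r & forall e, 0 < e -> e < r ->
      ((c - d)%:E <= separated_growth f e)%E) ->
  topological_entropy f = c%:E.
Proof.
move=> ub lb; apply: cvg_lim => //; apply/fine_cvgP.
have fin r e : ((c - r)%:E <= separated_growth f e)%E -> 0 < e ->
    (separated_growth f e)%E \is a fin_num.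
  move=> le e0; rewrite fin_numE; apply/andP; split.
    by apply/eqP => E; move: le; rewrite E leeNy_eq.
  by apply/eqP => E; have := ub e e0; rewrite E leye_eq.
split.
  have [r r0 rP] := lb 1 ltr01; near=> e.
  by apply: (@fin 1) => //; apply: rP => //; near: e; exact: nbhs_right_lt.
apply/cvgrPdist_le => d d0; have [r r0 rP] := lb d d0; near=> e.
have e0 : 0 < e by [].
have er : e < r by near: e; exact: nbhs_right_lt.
have le := rP e e0 er; have := ub e e0; move: (le).
rewrite -(fineK (fin _ _ le e0)) !lee_fin /= => ? ?.
by rewrite ger0_norm; lra.
Unshelve. all: by end_near. Qed.

End entropy_bounds.

(** * Growth rate from above *)

Section upper_growth.
Context {R : realType} {s : R} (hs : Num.sqrt 2 < s <= 2).
Local Notation X := (tent_invlim s).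

Let s0 : 0 < s. Proof. exact: slope_gt0 hs. Qed.

Let s1 : 1 <= s. Proof. exact: slope_ge1 hs. Qed.

Lemma uniform_continuity_iter (g : X -> X) (e : R) p : continuous g -> 0 < e ->
  exists n, forall i (x y : X), (i < p)%N -> x n = y n ->
    mdist (iter i g x) (iter i g y) <= e.
Proof.
move=> gc e0; suff : \forall n \near \oo, forall i (x y : X), (i < p)%N ->
    x n = y n -> mdist (iter i g x) (iter i g y) <= e.
  by move=> [n _ /(_ n (leqnn n))]; exists n.
elim: p => [|p IH]; first by exists 0%N.
have ic : continuous (iter p g) by exact: iter_continuous.
near=> n => i x y; rewrite ltnS leq_eqVlt => /orP[/eqP->|].
  by move: x y; near: n; exact: (uniform_continuity_coord s1).
by move: i x y; near: n.
Unshelve. all: by end_near. Qed.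

Lemma small_intervals_cover (e : R) n : 0 < e ->
  exists2 I : nat -> set R, forall l, @good R s e n (I l) &
    forall x : X, exists2 l, l \in iota 0 (Num.truncn (s ^+ n / e)).+1 & I l (x n).
Proof.
move=> e0; have sn0 : 0 < s ^+ n by rewrite exprn_gt0.
pose w := e / s ^+ n; have w0 : 0 < w by rewrite divr_gt0.
exists (fun l => [set u | (0 <= u <= s / 2) && (l%:R * w <= u <= l.+1%:R * w)]).
  move=> l; split.
  - move=> u v /= /andP[/andP[u0 _] /andP[ul _]] /andP[/andP[_ vs] /andP[_ vl]] z.
    move=> /andP[uz zv]; rewrite (le_trans u0 uz) (le_trans zv vs).
    by rewrite (le_trans ul uz) (le_trans zv vl).
  - by move=> u /andP[].
  - move=> j u v jn /= /andP[_ /andP[lu ul]] /andP[_ /andP[lv vl]].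
    rewrite (le_trans (iter_tent_lipschitz (ltW s0) _ _ _))//.
    apply: (@le_trans _ _ (s ^+ n * w)); last by rewrite mulrCA divff ?mulr1 ?gt_eqF.
    apply: ler_pM => //; [by rewrite exprn_ge0// ltW|by rewrite ler_weXn2l|].
    rewrite -natr1 mulrDl mul1r in ul vl.
    by move: (l%:R * w) lu lv ul vl => q *; rewrite ler_norml; apply/andP; split; lra.
move=> x; have x0 := coord_ge0 x n.
have xw : 0 <= x n / w by rewrite divr_ge0// ltW.
exists (Num.truncn (x n / w)).
  rewrite mem_iota add0n ltnS le_truncn// ler_pdivrMr// /w mulrA.
  by rewrite divfK ?gt_eqF// divff ?gt_eqF// coord_le1.
rewrite /= x0 coord_le ?(ltW s0)//=; have /andP[lx /ltW xl] := truncn_itv xw.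
by apply/andP; split; [rewrite -ler_pdivlMr|rewrite -ler_pdivrMr].
Qed.

Lemma separated_growth_upper (g f : X -> X) (kap : nat) (e : R) :
    continuous f -> continuous g -> cancel g f -> cancel f g ->
    (forall d, 0 < d -> exists N, forall y,
      linked d N (iter kap (@unshift R s) y) (g y)) ->
  0 < e -> (separated_growth g e <= (kap%:R * ln s)%:E)%E.
Proof.
move=> fc gc gK fK disp e0; apply/lee_addgt0Pr => d d0; rewrite -EFinD.
(* [card_orbit_separated_box] counts points separated by 8 times the size of the pieces. *)
have e80 : 0 < e / 8 by rewrite divr_gt0.
have [N gN] := disp _ e80.
pose M := (2 * N + 3)%N.
(* Chosen so that [C <= 2 * M^2 * p^3 <= (p * d)^4 / 24 <= expR (p * d)]: each block of [p] iterates
   then costs at most [p * d] in the exponent. *)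
pose p := (Num.truncn (48 * M%:R ^+ 2 / d ^+ 4)).+1.
have p0 : 0 < p%:R :> R by rewrite ltr0n.
have pbig : 48 * M%:R ^+ 2 <= p%:R * d ^+ 4.
  by rewrite -ler_pdivrMr ?exprn_gt0// ltW// truncnS_gt.
have [n1 unif] := uniform_continuity_iter p gc e80.
set C := ((p * ((p * N).+1 + 1 + (p * N).+1)).+1 * (2 * (p * N).+1).+1)%N.
have CM : (C <= 2 * M ^ 2 * p ^ 3)%N.
  have pM : ((p * N).+1 + 1 + (p * N).+1 <= p * M)%N.
    by rewrite /M mulnDr; have : (0 < p)%N by []; lia.
  have pM' : ((2 * (p * N).+1).+1 <= p * M)%N.
    by apply: leq_trans pM; lia.
  apply: leq_trans (leq_mul (_ : _ <= 2 * (p * (p * M)))%N pM') _.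
    apply: (@leq_ltn_trans (p * (p * M))); first by rewrite leq_mul2l pM orbT.
    by rewrite mul2n -addnn -[X in (X < _)%N]addn0 ltn_add2l !muln_gt0 /M addn3.
  by apply/eq_leq; rewrite !expnS expn0 !muln1; lia.
have Cexp : C%:R <= expR (p%:R * d).
  apply: (@le_trans _ _ (2 * M%:R ^+ 2 * p%:R ^+ 3)).
    by rewrite -!natrX -!natrM ler_nat.
  have pd0 : 0 <= p%:R * d by rewrite mulr_ge0// ltW.
  have := expR_ge1Dxn 3 pd0; rewrite (_ : 4`!%:R = 24)//.
  move/(le_trans _); apply.
  apply: (@le_trans _ _ ((p%:R * d) ^+ 4 / 24)); last by rewrite lerDr.
  have p30 : 0 <= p%:R ^+ 3 :> R by rewrite exprn_ge0// ltW.
  have := ler_wpM2l p30 pbig; rewrite ler_pdivlMr// exprMn (exprS p%:R 3).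
  move: (p%:R : R) (p%:R ^+ 3 : R) (M%:R ^+ 2 : R) (d ^+ 4) => t x y z.
  have -> : 2 * y * x * 24 = x * (48 * y) by ring.
  by have -> : t * x * z = x * (t * z) by ring.
have lns0 : 0 <= ln s by rewrite ln_ge0.
pose q := kap%:R * ln s + d.
have q0 : 0 <= q by rewrite /q addr_ge0 ?mulr_ge0// ltW.
(* The constant collects the bounded factors: the number of initial boxes relative to [s ^+ nn], the
   base level [n1], and the rounding of [n] up to a multiple of [p]. *)
apply: (@separated_growth_le _ _ g e (ln (1 + 8 / e) + n1%:R * ln s + p%:R * q)).
move=> n E n0 Es.
pose b := (n %/ p).+1; pose nn := (n1 + kap * (p * b))%N.
have npb : (n <= p * b)%N by rewrite mulnC ltnW// ltn_ceil.
have pbn : (p * b <= n + p)%N by rewrite mulnS addnC leq_add2r mulnC leq_trunc_div.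
have [I Ig Icov] := small_intervals_cover nn e80.
have Ele : (#|` E| <= (Num.truncn (s ^+ nn / (e / 8))).+1 * C ^ b)%N.
  rewrite -[X in (_ <= X * _)%N](size_iota 0).
  apply: (@card_fset_cover _ _ _ (fun l (x : X) => I l (x nn)) _ E (fun x _ => Icov x)).
  move=> l G _ GE GI.
  apply: (@card_orbit_separated_box _ _ hs (e / 8) e80 g f kap N fc gK fK gN
    p n1 b nn (I l)) => //.
  apply: (orbit_separated_leq npb); rewrite mulrCA divff ?mulr1//.
  by move=> x y xG yG; apply: Es; exact: (fsubsetP GE).
have snn1 : 1 <= s ^+ nn by rewrite exprn_ege1.
have e81 : 0 < 1 + 8 / e by rewrite addr_gt0// divr_gt0.
apply: (@le_trans _ _ ((s ^+ nn * (1 + 8 / e)) * expR (p%:R * d) ^+ b)).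
  move: Ele; rewrite -(ler_nat R) => /le_trans; apply; rewrite natrM natrX.
  apply: ler_pM; rewrite ?exprn_ge0//; last by rewrite lerXn2r ?nnegrE ?expR_ge0.
  rewrite -natr1 mulrDr mulr1 addrC lerD//.
  rewrite -[X in _ <= _ * X]invf_div truncn_le.
  by rewrite divr_ge0 ?exprn_ge0 ?ltW.
rewrite -[s ^+ nn](lnK (x := _)) ?posrE ?exprn_gt0// lnXn//.
rewrite -{1}[1 + 8 / e](lnK (x := _)) ?posrE//.
rewrite -expRM_natl -!expRD ler_expR.
rewrite -[X in X + _ + _]mulr_natl natrD mulrDl.
have : (p * b)%:R * q <= n%:R * q + p%:R * q.
  by rewrite -mulrDl -natrD ler_wpM2r// ler_nat.
rewrite /nn /q !natrM.
move: (n1%:R : R) (p%:R : R) (b%:R : R) (kap%:R : R) (n%:R : R) (ln s) (ln _).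
by move=> *; lra.
Qed.

End upper_growth.

(** * The lower bound *)

Section tent_separated.
Context {R : realType} {s : R} (s1 : 1 <= s).
Implicit Types (u v c e d : R).

Let s_gt0 : 0 < s. Proof. exact: lt_le_trans ltr01 s1. Qed.

Let s0 : 0 <= s. Proof. exact: ltW s_gt0. Qed.

Lemma iter_tent_turning q : exists C : seq R, forall u v, u <= v ->
    (forall c, c \in C -> ~ (u < c < v)) ->
  `|iter q (tent s) u - iter q (tent s) v| = s ^+ q * `|u - v|.
Proof.
elim: q => [|q [C CP]]; first by exists [::] => u v _ _; rewrite expr0 mul1r.
(* Turning points of [T^(q+1)]: the turning point 1/2 of [T], and the preimages of those of [T^q]
   under both branches. *)
exists (2^-1 :: [seq c / s | c <- C] ++ [seq 1 - c / s | c <- C]) => u v uv noC.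
have noh : (v <= 2^-1) || (2^-1 <= u).
  apply: contra_notT (noC 2^-1 (mem_head _ _)).
  by rewrite negb_or -!ltNge => /andP[-> ->].
have noL c : c \in C -> ~ (u < c / s < v).
  move=> cC; apply: noC; rewrite in_cons mem_cat.
  by apply/orP; right; apply/orP; left; apply/mapP; exists c.
have noR c : c \in C -> ~ (u < 1 - c / s < v).
  move=> cC; apply: noC; rewrite in_cons mem_cat.
  by apply/orP; right; apply/orP; right; apply/mapP; exists c.
rewrite !iterSr exprSr -mulrA; case/orP: noh => h.
  have uh := le_trans uv h.
  rewrite -(tent_same_branch s0); last by rewrite h uh.
  rewrite !(tent_left s0)//; apply: CP; first by rewrite ler_wpM2l.
  move=> c cC /andP[uc cv]; apply: (noL c cC).
  by rewrite ltr_pdivlMr// ltr_pdivrMr// mulrC uc mulrC cv.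
have hv := le_trans h uv.
rewrite -(tent_same_branch s0); last by rewrite h hv orbT.
rewrite !(tent_right s0)// distrC [X in _ = _ * X]distrC; apply: CP.
  by rewrite ler_wpM2l// lerB.
move=> c cC /andP[uc cv]; apply: (noR c cC).
apply/andP; split.
  by rewrite ltrBrDl -ltrBrDr ltr_pdivrMr// mulrC.
by rewrite ltrBlDr -ltrBlDl ltr_pdivlMr// mulrC.
Qed.

(** Applied to turning points: a set of diameter at most [e] straddles at most one of them. *)
Lemma seq_min_gap (C : seq R) : exists2 e, 0 < e &
  forall c c', c \in C -> c' \in C -> c != c' -> e < `|c - c'|.
Proof.
have gap1 c : exists2 e, 0 < e & forall c', c' \in C -> c != c' -> e < `|c - c'|.
  elim: C => [|a C [e e0 eP]]; first by exists 1.
  have [<-|ca] := eqVneq c a.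
    exists e => // c'; rewrite in_cons => /orP[/eqP->|]; first by rewrite eqxx.
    exact: eP.
  have ca0 : 0 < `|c - a| by rewrite normr_gt0 subr_eq0.
  exists (Num.min e (`|c - a| / 2)); first by rewrite lt_min e0 divr_gt0.
  move=> c'; rewrite in_cons gt_min => /orP[/eqP-> _|c'C cc']; last by rewrite eP.
  by rewrite ltr_pdivrMr// ltr_pMr// ltr1n orbT.
elim: {1}C => [|a D [e e0 eP]]; first by exists 1.
have [r r0 rP] := gap1 a.
exists (Num.min e r); first by rewrite lt_min e0.
move=> c c'; rewrite in_cons => /orP[/eqP->|cD] c'C cc'.
  by rewrite gt_min rP// orbT.
by rewrite gt_min eP.
Qed.

(* Under T^q, a set of small diameter splits at its only turning point into two parts
   on which T^q is a similarity of ratio s^q. *)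
Lemma card_bowen_ball (K : choiceType) q (C : seq R) e d M (u : K -> R) (S : {fset K}) :
    (forall u v, u <= v -> (forall c, c \in C -> ~ (u < c < v)) ->
      `|iter q (tent s) u - iter q (tent s) v| = s ^+ q * `|u - v|) ->
    (forall c c', c \in C -> c' \in C -> c != c' -> e < `|c - c'|) ->
    (forall x y, x \in S -> y \in S -> x <> y -> d <= `|u x - u y|) ->
    (forall i x y, (i <= M)%N -> x \in S -> y \in S ->
      `|iter (q * i) (tent s) (u x) - iter (q * i) (tent s) (u y)| <= e) ->
    e < d * s ^+ (q * M) ->
  (#|` S| <= 2 ^ M)%N.
Proof.
move=> CP gap; elim: M d u S => [|M IH] d u S Sd Se ed.
  rewrite expn0; apply: (@card_fset_intervals R _ nat (fun=> set0) u [::] S).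
    by move=> _ ? ? [].
  move=> x y xS yS xy; have := Se 0%N x y isT xS yS; rewrite muln0/= => xye.
  have := Sd x y xS yS xy; move: ed; rewrite muln0 expr0 mulr1.
  by move=> /lt_le_trans/[apply]; rewrite ltNge xye.
have S0 x y : x \in S -> y \in S -> `|u x - u y| <= e.
  by move=> xS yS; have := Se 0%N x y isT xS yS; rewrite muln0.
have [c cP] : exists c, forall x y, x \in S -> y \in S -> u x <= u y ->
    (u x <= c) = (u y <= c) -> forall c', c' \in C -> ~ (u x < c' < u y).
  have [[c [x0 [y0 [[cC x0S y0S] xcy]]]]|noc] := pselect (exists c x y,
      [/\ c \in C, x \in S & y \in S] /\ u x < c < u y); last first.
    (* No turning point is straddled, so any cut would do. *)
    exists 0 => x y xS yS _ _ c' c'C xcy; apply: noc.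
    by exists c', x, y.
  exists c => x y xS yS xy xcy' c' c'C /andP[xc' c'y].
  have [cc'|/(gap _ _ cC c'C)] := eqVneq c c'.
    by move: xcy'; rewrite cc' (ltW xc') leNgt c'y.
  have := S0 _ _ x0S y0S; have := S0 _ _ x0S yS.
  have := S0 _ _ xS y0S; have := S0 _ _ xS yS.
  move: xcy => /andP[? ?]; rewrite !ler_norml ltNge.
  move=> /andP[? ?] /andP[? ?] /andP[? ?] /andP[? ?] /negP; apply.
  by rewrite ler_norml; apply/andP; split; lra.
rewrite expnS; apply: (@card_fset_cover _ _ [:: true; false]
    (fun b x => (u x <= c) = b)) => [x _|b S' _ S'S S'b].
  by exists (u x <= c) => //; case: (u x <= c).
have sim x y : x \in S' -> y \in S' -> `|iter q (tent s) (u x) -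
    iter q (tent s) (u y)| = s ^+ q * `|u x - u y|.
  wlog xy : x y / u x <= u y.
    move=> W xS' yS'; have [|/ltW] := leP (u x) (u y) => xy; first exact: W.
    by rewrite distrC (W y x)// distrC.
  move=> xS' yS'; apply: CP => //; apply: cP; rewrite ?S'b//; exact: (fsubsetP S'S).
apply: (IH (s ^+ q * d) (iter q (tent s) \o u)).
- move=> x y xS' yS' xy; rewrite /= sim// ler_wpM2l ?exprn_ge0//.
  by apply: Sd => //; exact: (fsubsetP S'S).
- move=> i x y iM xS' yS'; rewrite /= -!iterD addnC -mulnS.
  by apply: Se => //; exact: (fsubsetP S'S).
- by rewrite [X in X * _]mulrC -mulrA -exprD -mulnS.
Qed.

(** With [e] a lower bound for the gaps of turning points, a grid of mesh [2 * e / s ^+ (q * M)] on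
    [[0, 1/2]] is thinned to a maximal set separated by [e / 2]. The classes have diameter at most
    [e] at all times, hence at most [2 ^ M] points by [card_bowen_ball]. *)
Lemma tent_separated q : exists e A : R, [/\ 0 < e, 0 < A & forall M,
  exists (E : {fset nat}) (u : nat -> R),
  [/\ forall j, j \in E -> 0 <= u j <= s / 2,
      forall i j, i \in E -> j \in E -> i <> j -> exists2 k, (k <= M)%N &
        e < `|iter (q * k) (tent s) (u i) - iter (q * k) (tent s) (u j)| &
      A * (s ^+ q / 2) ^+ M <= #|` E|%:R]].
Proof.
have [C CP] := iter_tent_turning q; have [e e0 gap] := seq_min_gap C.
exists (e / 2), (4 * e)^-1; split; rewrite ?divr_gt0 ?invr_gt0 ?mulr_gt0// => M.
pose d := 2 * e / s ^+ (q * M).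
have sM0 : 0 < s ^+ (q * M) by rewrite exprn_gt0.
have d0 : 0 < d by rewrite divr_gt0 ?mulr_gt0.
pose G := Num.truncn ((2 * d)^-1).
pose S := seq_fset tt (iota 0 G.+1).
have SE j : (j \in S) = (j <= G)%N by rewrite seq_fsetE mem_iota.
have cS : #|` S| = G.+1 by rewrite size_seq_fset undup_id ?iota_uniq// size_iota.
pose u (j : nat) : R := j%:R * d.
pose close i j := forall k, (k <= M)%N ->
  `|iter (q * k) (tent s) (u i) - iter (q * k) (tent s) (u j)| <= e / 2.
have [|i j ij k kM|E [ES Esep Ecov]] := @maximal_separated _ close S.
- by move=> i k _; rewrite subrr normr0 divr_ge0// ltW.
- by rewrite distrC ij.
exists E, u; split.
- move=> j /(fsubsetP ES); rewrite SE => jG; rewrite /u mulr_ge0 ?(ltW d0)//=.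
  have d20 : 0 <= (2 * d)^-1 by rewrite invr_ge0 mulr_ge0// ltW.
  have : j%:R <= (2 * d)^-1 by rewrite (le_trans (_ : _ <= G%:R)) ?ler_nat// truncn_le.
  rewrite invfM -ler_pdivrMr ?invr_gt0// invrK => /le_trans; apply.
  by rewrite ler_pdivlMr// mulVf.
- move=> i j iE jE ij; have := Esep i j iE jE ij.
  move=> /existsNP[k] /not_implyP[kM] /negP.
  by rewrite -ltNge; exists k.
- have : (#|` S| <= #|` E| * 2 ^ M)%N.
    apply: (@card_fset_cover _ _ (enum_fset E) (fun j i => close j i)) => // j F jE FS Fj.
    apply: (@card_bowen_ball _ q C e d M u) => //.
    + move=> x y xF yF xy; rewrite /u -mulrBl normrM (gtr0_norm d0) ler_peMl ?(ltW d0)//.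
      have [xy'|yx|//] := ltngtP x y.
      * by rewrite distrC -natrB ?(ltnW xy')// normr_nat ler1n subn_gt0.
      * by rewrite -natrB ?(ltnW yx)// normr_nat ler1n subn_gt0.
    + move=> i x y iM xF yF; rewrite (splitr e).
      rewrite (le_trans (ler_distD (iter (q * i) (tent s) (u j)) _ _))//.
      by rewrite lerD// ?Fj// distrC Fj.
    + by rewrite /d divfK ?gt_eqF// mulr_natl mulr2n ltrDl.
  rewrite cS -(ler_nat R) natrM natrX => GE.
  rewrite expr_div_n -exprM mulrA ler_pdivrMr ?exprn_gt0//.
  apply: le_trans GE; apply: le_trans (ltW (truncnS_gt _)).
  have -> : 2 * d = 4 * e / s ^+ (q * M) by rewrite /d !mulrA -natrM.
  by rewrite invf_div mulrC.
Qed.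

End tent_separated.

(** * Growth rate from below *)

Section lower_growth.
Context {R : realType} {s : R} (hs : Num.sqrt 2 < s <= 2).
Local Notation X := (tent_invlim s).
Local Notation lam := (@contraction_rate R s).

Let s0 : 0 < s. Proof. exact: slope_gt0 hs. Qed.

Let s1 : 1 <= s. Proof. exact: slope_ge1 hs. Qed.

Variables (g : X -> X) (kap N : nat).
Hypothesis kap0 : (0 < kap)%N.
Hypothesis gN : forall y, linked 1 N (iter kap (@unshift R s) y) (g y).

(** [B = N / (1 - lam)] solves [N + lam * B = B]: the last application of [g] costs [N * lam ^+ j],
    and the former ones are read in coordinate [j + kap], where the error is smaller by a factor
    [lam] at least. *)
Lemma iter_coord_close a (x : X) j :
  `|iter a g x j - x (j + kap * a)%N| <= N%:R / (1 - lam) * lam ^+ j.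
Proof.
have lam1 : 0 < 1 - lam by rewrite subr_gt0 (contraction_rate_lt1 hs).
have lamj i : 0 < lam ^+ i by exact: (contraction_rateX_gt0 hs).
have B0 : 0 <= N%:R / (1 - lam) by rewrite divr_ge0// ltW.
elim: a j => [|a IH] j.
  by rewrite muln0 addn0 subrr normr0 mulr_ge0// ltW.
have step := linked_dist j (gN (iter a g x)).
rewrite iter_unshift_coord mulr1 distrC in step.
rewrite (le_trans (ler_distD (iter a g x (j + kap)%N) _ _))//=.
have IHj := IH (j + kap)%N; rewrite -addnA -mulnS in IHj.
have lamk : lam ^+ (j + kap) <= lam * lam ^+ j.
  rewrite -exprS -addn1 -(subnKC kap0) addnA exprD ler_piMr ?(ltW (lamj _))//.
  exact: (contraction_rateX_le1 hs).
apply: le_trans (lerD step IHj) _.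
apply: le_trans (lerD (lexx _) (ler_wpM2l B0 lamk)) _.
rewrite mulrA -mulrDl ler_wpM2r ?(ltW (lamj _))//.
have NB : N%:R / (1 - lam) * (1 - lam) = N%:R by rewrite divfK ?gt_eqF.
by rewrite -{1}NB -mulrDr subrK mulr1.
Qed.

Lemma separated_growth_lower (d : R) : 0 < d ->
  exists2 r : R, 0 < r & forall e, 0 < e -> e < r ->
    ((kap%:R * ln s - d)%:E <= separated_growth g e)%E.
Proof.
(* Turning points cost a factor 2 per [q] iterates of [tent s], that is per [q0] iterates of [g];
   the loss [ln 2 / q0] is at most [d]. *)
move=> d0; pose q0 := (Num.truncn (ln 2 / d)).+1; pose q := (kap * q0)%N.
have q0d : ln 2 <= q0%:R * d :> R by rewrite -ler_pdivrMr// ltW// truncnS_gt.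
have [e0 [A [e00 A0 sep]]] := tent_separated s1 q.
have lam1 : 0 < 1 - lam by rewrite subr_gt0 (contraction_rate_lt1 hs).
have lam0 : 0 < lam by exact: (contraction_rate_gt0 hs).
pose B : R := N%:R / (1 - lam) + 1.
have B0 : 0 < B by rewrite ltr_wpDl// divr_ge0// ltW.
have [L LB] : exists L, B * lam ^+ L < e0 / 4.
  have h : `|lam| < 1 by rewrite gtr0_norm// (contraction_rate_lt1 hs).
  have eB : 0 < e0 / 4 / B by rewrite !divr_gt0.
  have /cvgrPdist_lt/(_ _ eB)[L _ /(_ L (leqnn L))] := cvg_expr h.
  rewrite sub0r normrN normrX gtr0_norm// => ?; exists L.
  by rewrite mulrC -ltr_pdivlMr.
have BL : N%:R / (1 - lam) * lam ^+ L < e0 / 4.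
  by rewrite (le_lt_trans _ LB)// ler_wpM2r ?exprn_ge0 ?(ltW lam0)// lerDl.
(* Of a gap [e0] in coordinate [L], two errors below [e0 / 4] leave more than [e0 / 2], and this
   coordinate is [2 ^+ L]-Lipschitz. *)
exists (e0 / 2 / 2 ^+ L); first by rewrite !divr_gt0 ?exprn_gt0.
move=> e e_gt0 er; pose c := kap%:R * ln s - d.
(* [ln A] accounts for the factor [A], and [c] for the additional unit in the length
   [(q0 * M).+1]. *)
apply: (@separated_growth_ge _ _ g e (c - ln A)) => n0.
have [E [u [u01 Esep Ecard]]] := sep n0.+1.
pose M := n0.+1; pose v j := lift hs (L + q * M) (u j).
have vsep i j : i \in E -> j \in E -> i <> j -> exists2 a, (a < (q0 * M).+1)%N &
    e < mdist (iter a g (v i)) (iter a g (v j)).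
  move=> iE jE ij; have [k kM ek] := Esep i j iE jE ij.
  (* [g] follows the inverse shift, so time is reversed: the iterate [q * k] of [tent s] is seen in
     coordinate [L] after [q0 * (M - k)] steps. *)
  exists (q0 * (M - k))%N; first by rewrite ltnS leq_mul2l leq_subr orbT.
  have qk : (kap * (q0 * (M - k)) = q * M - q * k)%N by rewrite mulnA -/q mulnBr.
  have qkM : (q * k <= q * M)%N by rewrite leq_mul2l kM orbT.
  have vE l : l \in E ->
      v l (L + kap * (q0 * (M - k)))%N = iter (q * k) (tent s) (u l).
    move=> lE; rewrite qk /v lift_le ?u01// ?leq_add2l ?leq_subr//.
    by rewrite subnDl subKn.
  have ci := iter_coord_close (q0 * (M - k)) (v i) L.
  have cj := iter_coord_close (q0 * (M - k)) (v j) L.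
  rewrite !vE// in ci cj.
  apply: lt_le_trans er _; rewrite ler_pdivrMr ?exprn_gt0// [leRHS]mulrC.
  apply: le_trans (coord_dist_le_mdist _ _ L).
  have := ler_distD (iter (q0 * (M - k)) g (v i) L)
    (iter (q * k) (tent s) (u i)) (iter (q * k) (tent s) (u j)).
  have := ler_distD (iter (q0 * (M - k)) g (v j) L)
    (iter (q0 * (M - k)) g (v i) L) (iter (q * k) (tent s) (u j)).
  rewrite distrC in ci.
  by move: ci cj ek BL; lra.
have vinj : {in E &, injective v}.
  move=> i j iE jE vij; apply/eqP/negPn/negP => /eqP ij.
  have [a _] := vsep i j iE jE ij.
  by rewrite vij mdistxx ltNge ltW.
exists (q0 * M).+1, (v @` E)%fset; split.
- by rewrite ltnS /M; apply: leq_trans (leq_pmull _ _).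
- move=> _ _ /imfsetP[i /= iE ->] /imfsetP[j /= jE ->] vij.
  have ij : i <> j by move=> ij; apply: vij; rewrite ij.
  by have [a aM ea] := vsep i j iE jE ij; exists a.
- rewrite card_in_imfset//; apply: le_trans Ecard.
  have sq0 : 0 < s ^+ q / 2 by rewrite divr_gt0 ?exprn_gt0.
  rewrite -[A * _]lnK ?posrE ?mulr_gt0 ?exprn_gt0// ler_expR.
  rewrite lnM ?posrE ?exprn_gt0// lnXn// ln_div ?posrE ?exprn_gt0// lnXn//.
  rewrite -[ln s *+ q]mulr_natl -[(_ - _) *+ _]mulr_natl /c /q natrM -natr1 natrM.
  rewrite -/M.
  have : M%:R * ln 2 <= M%:R * (q0%:R * d) :> R by rewrite ler_wpM2l.
  move: (M%:R : R) (q0%:R : R) (kap%:R : R) (ln s) (ln A) (ln 2).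
  by move=> *; lra.
Qed.

End lower_growth.

(** * From displacement to entropy *)

Section displacement.
Context {R : realType} {s : R} (hs : Num.sqrt 2 < s <= 2).
Local Notation X := (tent_invlim s).

Lemma iter_unshift_shift k (x : X) :
  iter k (@unshift R s) (iter k (Defs.shift (slope_itv hs)) x) = x.
Proof. by elim: k x => // k IH x; rewrite iterSr iterS shiftK IH. Qed.

Lemma topological_entropy_displacement (g f : X -> X) (kap : nat) :
    continuous f -> continuous g -> cancel g f -> cancel f g ->
    (forall d, 0 < d -> exists N, forall y,
      linked d N (iter kap (@unshift R s) y) (g y)) ->
  topological_entropy g = (kap%:R * ln s)%:E.
Proof.
move=> fc gc gK fK disp; apply: topological_entropyE => [e|d d0].
  exact: separated_growth_upper hs _ _ _ _ fc gc gK fK disp.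
(* The geometric series in [iter_coord_close] requires [kap > 0]; for [kap = 0] the lower bound is
   nonnegativity, seen on a single point. *)
have [kap0|kap_gt0] := posnP kap.
  exists 1 => // e e0 _; apply: le_trans (separated_growth_ge0 (lift hs 0 0) g e).
  by rewrite kap0 mul0r sub0r lee_fin oppr_le0 ltW.
by have [N gN] := disp 1 ltr01; exact: (separated_growth_lower hs kap_gt0 gN).
Qed.

End displacement.

Theorem theorem1p1 (R : realType) (s : R) (hs : Num.sqrt 2 < s <= 2)
    (h : tent_invlim s -> tent_invlim s) (k : int) :
  homeomorphism h ->
  isotopic R h (shift_pow (slope_itv hs) k) ->
  topological_entropy h = (`|k|%:~R * ln s)%:E.
Proof.
move=> [hc [g [gc hK gK]]] [H [Hc H0 H1 _]].
case: k H1 => n H1.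
  (* For [k >= 0] the inverse [g] is used: the path at [g y] joins [y] to [sigma^n (g y)], and
     [sigma^-n] turns it into one from [sigma^-n y] to [g y]. *)
  rewrite (topological_entropy_inv hK gK).
  apply: (topological_entropy_displacement hs hc gc gK hK) => d d0.
  have [N HN] := homotopy_linked hs Hc d0; exists N => y.
  have := linked_iter_unshift hs n (ltW d0) (HN (g y)).
  by rewrite H0 H1 /= gK iter_unshift_shift.
(* Here [h] itself follows [sigma^-(n+1)], and the chains need only be reversed. *)
rewrite (_ : `|Negz n|%:~R = n.+1%:R)//.
apply: (topological_entropy_displacement hs gc hc hK gK) => d d0.
have [N HN] := homotopy_linked hs Hc d0; exists N => y.
by apply: linked_sym; have := HN y; rewrite H0 H1.
Qed.
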